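(* Let $\phi,\varphi:[0,\infty)\to[0,\infty)$, where $\phi$ is convex, monotonically increasing and satisfies $\phi(xy)\le\varphi(x)\phi(y)$ for all $x,y\ge 0$. Let $p,q\in\mathcal{P}([0,1])$ with $1/p(x)+1/q(x)=1$, let $F:(0,\infty)\times\mathbb{R}\to(0,\infty)$, let $\psi\in L^1(\mathbb{R})$, and let $(a_k)_{k\in\mathbb{Z}}$ be a sequence of positive real numbers with $\sum_{k\in\mathbb{Z}}a_k=1$. Let $f\in L^\infty(\mathbb{R}:X)$ be equi-Weyl-$[p,\phi,F]$-almost periodic [respectively, Weyl-$[p,\phi,F]$-almost periodic]. Then the function $$(\psi*f)(x):=\int_{-\infty}^{+\infty}\psi(x-y)f(y)\,dy,\quad x\in\mathbb{R},$$ belongs to $L^\infty(\mathbb{R}:X)$. Furthermore, if $p_1\in\mathcal{P}([0,1])$, $F_1:(0,\infty)\times\mathbb{R}\to(0,\infty)$ and if for every $t\in\mathbb{R}$ and $l>0$ $$\int_0^1\varphi_{p_1(x)}\Biggl(2F_1(l,t)\sum_{k\in\mathbb{Z}}\frac{\bigl\|\varphi\bigl(la_k^{-1}|\psi(xl-(z+k)l)|\bigr)\bigr\|_{L^{q(z)}[0,1]}}{F(l,t+kl)}\Biggr)\,dx\le1 ,$$ then $\psi*f$ is equi-Weyl-$[p_1,\phi,F_1]$-almost periodic [respectively, Weyl-$[p_1,\phi,F_1]$-almost periodic].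
   Context: $X$ is a complex Banach space. $\mathcal{P}([0,1])$ is the set of Lebesgue measurable $p:[0,1]\to[1,\infty]$ (with $1/\infty=0$). For $t\ge 0$: $\varphi_{p(x)}(t)=t^{p(x)}$ if $p(x)<\infty$; if $p(x)=\infty$, $\varphi_{p(x)}(t)=0$ for $0\le t\le 1$ and $\varphi_{p(x)}(t)=\infty$ for $t>1$. (The indexed $\varphi_{p(x)}$ is not related to the function $\varphi$.) A measurable $u$ on $[0,1]$ belongs to $L^{p(x)}([0,1])$ iff $\int_0^1\varphi_{p(x)}(\lambda\|u(x)\|)dx<\infty$ for some $\lambda>0$, and $\|u\|_{L^{p(\cdot)}[0,1]}=\inf\{\lambda>0:\int_0^1\varphi_{p(x)}(\|u(x)\|/\lambda)\,dx\le 1\}$; in $\|\cdot\|_{L^{q(z)}[0,1]}$ the variable is $z$. Let $p\in\mathcal{P}([0,1])$, $\phi:[0,\infty)\to[0,\infty)$, $F:(0,\infty)\times\mathbb{R}\to(0,\infty)$, and let $f:\mathbb{R}\to X$ be such that $\phi(\|f(\cdot\, l+t+\tau)-f(t+\cdot\, l)\|)\in L^{p(x)}([0,1])$ for all $\tau,t\in\mathbb{R}$, $l>0$. Then $f$ is: - equi-Weyl-$[p,\phi,F]$-almost periodic iff for each $\epsilon>0$ there are $l>0$, $L>0$ such that every interval $I'\subseteq\mathbb{R}$ of length $L$ contains $\tau$ with $\sup_{t\in\mathbb{R}}F(l,t)\,\bigl\|\phi(\|f(\cdot\, l+t+\tau)-f(t+\cdot\, l)\|)\bigr\|_{L^{p(\cdot)}[0,1]}\le\epsilon$;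 - Weyl-$[p,\phi,F]$-almost periodic iff for each $\epsilon>0$ there is $L>0$ such that every interval $I'\subseteq\mathbb{R}$ of length $L$ contains $\tau$ with $\limsup_{l\to\infty}\sup_{t\in\mathbb{R}}F(l,t)\,\bigl\|\phi(\|f(\cdot\, l+t+\tau)-f(t+\cdot\, l)\|)\bigr\|_{L^{p(\cdot)}[0,1]}\le\epsilon$. *)

(* Defs.v *)
From HB Require Import structures.
From mathcomp Require Import all_boot all_order all_algebra.
From mathcomp Require Import all_classical all_reals all_analysis.
From mathcomp Require Import measurable_realfun ess_sup_inf.
From mathcomp Require Import complex.

Set Implicit Arguments.
Unset Strict Implicit.
Unset Printing Implicit Defensive.

Import Order.TTheory GRing.Theory Num.Theory.
Import numFieldNormedType.Exports.

Local Open Scope classical_set_scope.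
Local Open Scope complex_scope.
Local Open Scope ring_scope.

(* [lebR R] is (convertible to) [R], but carries the complete sigma-algebra of
   Lebesgue measurable sets instead of the Borel one. *)
Notation lebR R := (caratheodory_type ((wlength (@idfun R))^*)%mu).

Definition leb (R : realType) : {measure set (lebR R) -> \bar R} :=
  completed_lebesgue_measure.

(* In a normed module over [R[i]] the library norm is an element of [R[i]]
   with zero imaginary part. *)
Definition rnorm (R : realType) (X : normedModType R[i]) (x : X) : R :=
  complex.Re `|x|.

Definition cabs (R : realType) (z : R[i]) : R := complex.Re `|z|.

Section Bochner.
Context (R : realType) (X : completeNormedModType R[i]).
Implicit Types (f s : R -> X).

Definition simple_function s :=
  finite_set (range s) /\
  forall v : X, measurable (s @^-1` [set v] : set (lebR R)).

Definition integrable_simple s :=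
  simple_function s /\
  forall v : X, v != 0 -> (leb R (s @^-1` [set v]) < +oo)%E.

(* For [v = 0] the measure may be infinite; [fine +oo = 0] is harmless. *)
Definition simple_integral s : X :=
  \sum_(v \in range s) (fine (leb R (s @^-1` [set v])))%:C *: v.

Definition strongly_measurable f :=
  exists s : nat -> R -> X,
    (forall n, simple_function (s n)) /\
    {ae leb R, forall x, s n x @[n --> \oo] --> f x}.

Definition is_bochner_integral f (J : X) :=
  strongly_measurable f /\
  exists s : nat -> R -> X,
    [/\ forall n, integrable_simple (s n),
        (\int[leb R]_x (rnorm (f x - s n x))%:E)%E @[n --> \oo] --> 0%E &
        simple_integral (s n) @[n --> \oo] --> J].

Definition bochner_integrable f := exists J, is_bochner_integral f J.

Definition bochner_integral f : X := xget 0 (is_bochner_integral f).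

Definition in_Linfty f :=
  strongly_measurable f /\
  (ess_sup (leb R) (fun x => (rnorm (f x))%:E) < +oo)%E.

End Bochner.

Definition in_L1 (R : realType) (psi : R -> R[i]) :=
  [/\ measurable_fun [set: lebR R] (fun x : lebR R => complex.Re (psi x)),
      measurable_fun [set: lebR R] (fun x : lebR R => complex.Im (psi x)) &
      (\int[leb R]_x (cabs (psi x))%:E < +oo)%E].

Definition convolution (R : realType) (X : completeNormedModType R[i])
    (psi : R -> R[i]) (f : R -> X) (x : R) : X :=
  bochner_integral (fun y => psi (x - y) *: f y).

Section VariableExponent.
Context (R : realType).
Implicit Types (p : R -> \bar R) (u : R -> R).
Local Open Scope ereal_scope.

Definition exponent p :=
  measurable_fun (`[0%R, 1%R] : set (lebR R)) p /\
  forall x : R, (0 <= x <= 1)%R -> 1 <= p x.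

(* The argument [t] is extended-valued, with value [+oo] at [t = +oo]. *)
Definition vphi (r t : \bar R) : \bar R :=
  match r with
  | r'%:E => poweR t r'
  | _ => if t <= 1 then 0 else +oo
  end.

Definition modular p (v : R -> \bar R) : \bar R :=
  \int[leb R]_(x in (`[0%R, 1%R] : set (lebR R))) vphi (p x) (v x).

Definition in_Lp p u :=
  measurable_fun (`[0%R, 1%R] : set (lebR R)) u /\
  exists2 lam : R, (0 < lam)%R & modular p (fun x => (lam * `|u x|)%:E) < +oo.

(* The norm is [+oo] outside of the space, in particular when [u] is not
   measurable on [[0, 1]]. *)
Definition Lp_norm p u : \bar R :=
  ereal_inf [set lam%:E | lam in [set lam : R |
    [/\ measurable_fun (`[0%R, 1%R] : set (lebR R)) u, (0 < lam)%R &
        modular p (fun x => (`|u x| / lam)%:E) <= 1]]].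

End VariableExponent.

Section Weyl.
Context (R : realType) (X : completeNormedModType R[i]).
Variables (p : R -> \bar R) (phi : R -> R) (F : R -> R -> R) (f : R -> X).

Definition increment (l t tau x : R) : R :=
  phi (rnorm (f (x * l + t + tau) - f (t + x * l))).

Definition increments_in_Lp :=
  forall tau t l : R, 0 < l -> in_Lp p (increment l t tau).

Definition sup_increment (tau l : R) : \bar R :=
  ereal_sup (range (fun t : R =>
    ((F l t)%:E * Lp_norm p (increment l t tau))%E)).

Definition equi_weyl_ap :=
  increments_in_Lp /\
  forall eps : R, 0 < eps -> exists l L : R, [/\ 0 < l, 0 < L &
    forall I : set R, is_interval I -> leb R I = L%:E ->
      exists2 tau, I tau & (sup_increment tau l <= eps%:E)%E].

Definition weyl_ap :=
  increments_in_Lp /\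
  forall eps : R, 0 < eps -> exists L : R, 0 < L /\
    forall I : set R, is_interval I -> leb R I = L%:E ->
      exists2 tau, I tau &
        (limf_esup (sup_increment tau) (pinfty_nbhs R) <= eps%:E)%E.

End Weyl.

(* Main.v *)
Require Import Defs.
From HB Require Import structures.
From mathcomp Require Import all_boot all_order all_algebra.
From mathcomp Require Import all_classical all_reals all_analysis.
From mathcomp Require Import measurable_realfun ess_sup_inf.
From mathcomp Require Import complex ring lra.

Set Implicit Arguments.
Unset Strict Implicit.
Unset Printing Implicit Defensive.

Import Order.TTheory GRing.Theory Num.Theory.
Import numFieldNormedType.Exports.

Local Open Scope classical_set_scope.
Local Open Scope complex_scope.
Local Open Scope ring_scope.

(** Put [g y = f (y + tau) - f y]. Moving the translation by [tau] from [psi] to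
    [f], the increment of [psi * f] from [x l + t] to [x l + t + tau] is the
    Bochner integral of [psi (x l + t - y) *: g y], so its norm [N] is at most
    the integral of [|psi (x l + t - y)| |g y|]
    ([convolution_increment_le]). Cut the line into the intervals
    [[t + k l, t + (k + 1) l]] and rescale each of them to [[0, 1]]
    ([lintegral_split]). The bound becomes the sum over [k] of
    [a_k * \int_0^1 h_k], where
    [h_k z = (l / a_k) |psi (x l - (z + k) l)| |g (t + k l + z l)|]. Since the
    weights [a_k] have sum 1, this is a mean, and Jensen's inequality
    ([jensen_series]) gives [phi N <= \sum_k a_k * \int_0^1 phi (h_k)].

    Now [phi (u v) <= varphi u * phi v] separates [psi] from [f], and the
    Hoelder inequality for variable exponents, whose constant is 2
    ([Lp_norm_hoelder]), bounds the [k]-th integral by twice the product of the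
    [q]-norm of [varphi ((l / a_k) |psi|)] and the [p]-norm of [phi |g|] on the
    [k]-th interval. If [F (l, s)] times the latter norm is at most [e] for all
    [s], then [phi N] is at most [2 e] times the series in the hypothesis on
    [p1] and [F1] ([phi_increment_le]). By that hypothesis,
    [F1 (l, t)] times the [p1]-norm of the increments of [psi * f] is then
    at most [e]. Thus, for the same [l] and [tau], the supremum that measures the
    almost periodicity of [psi * f] is at most the one of [f]
    ([sup_increment_convolution_le]), and both notions pass from [f] to
    [psi * f].

    It remains to see that the convolution is well defined and in [Linfty]. The
    Bochner integrals exist because the product is strongly measurable and its
    norm is integrable ([bochner_integrable_norm]), and their norm is at most
    the [L1] norm of [psi] times the essential bound of [f]. The convolution is
    continuous, since translation is continuous in [L1]
    ([L1_continuous_integrable]), and a continuous function on the line is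
    strongly measurable. *)

(** * Lebesgue measure and affine maps *)

Section LebesgueBasics.
Context {R : realType}.
Implicit Types (A : set R) (r b : R).

Lemma measurable_leb A : measurable A -> measurable (A : set (lebR R)).
Proof. by move=> mA; apply: sub_caratheodory. Qed.

Lemma measurable_leb_itv (i : interval R) : measurable ([set` i] : set (lebR R)).
Proof. by apply: measurable_leb; exact: measurable_itv. Qed.

Lemma measurable_leb_id : measurable_fun [set: lebR R] (fun x : lebR R => x : R).
Proof. by move=> _ B mB; rewrite setTI; exact: measurable_leb. Qed.

Lemma leb_itv (i : interval R) :
  leb R [set` i] = (if (i.1 < i.2)%E then (i.2 : \bar R) - i.1 else 0)%E.
Proof. exact: (lebesgue_measure_itv i). Qed.

Lemma leb_mono A B : A `<=` B -> (leb R A <= leb R B)%E.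
Proof. by move=> AB; exact: (@le_mu_ext _ _ _ (wlength idfun) A B AB). Qed.

Definition affine r b (x : R) : R := r * x + b.

Lemma affineK r b : r != 0 -> cancel (affine r b) (affine r^-1 (- (r^-1 * b))).
Proof. by move=> r0 x; rewrite /affine; field. Qed.

Lemma affineVK r b : r != 0 -> cancel (affine r^-1 (- (r^-1 * b))) (affine r b).
Proof. by move=> r0 x; rewrite /affine; field. Qed.

(** For [r < 0] the preimage is closed on the left and open on the right: it is
    not a set of the covering family, but it has the same length. *)
Let affine_itvoc r b (x y : R) : r != 0 -> x < y ->
  leb R (affine r b @^-1` `]x, y]%classic) = (`|r|^-1 * (y - x))%:E.
Proof.
move=> r0 xy; case: (ltrgt0P r) r0 => // [rp|rn] _.
- rewrite (_ : _ @^-1` _ = `]r^-1 * (x - b), r^-1 * (y - b)]%classic).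
    rewrite leb_itv /= lte_fin ltr_pM2l ?invr_gt0// ltrD2r xy -EFinB.
    by congr EFin; ring.
  apply/seteqP; split=> z; rewrite /affine /= !in_itv /=;
    by rewrite ltr_pdivrMl// ler_pdivlMl// ltrBlDr lerBrDr.
- rewrite (_ : _ @^-1` _ = `[r^-1 * (y - b), r^-1 * (x - b)[%classic).
    rewrite leb_itv /= lte_fin ltr_nM2l ?invr_lt0// ltrD2r xy -EFinB.
    by congr EFin; rewrite invrN; ring.
  apply/seteqP; split=> z; rewrite /affine /= !in_itv /=;
    by rewrite ltr_ndivlMl// ler_ndivrMl// ltrBlDr lerBrDr andbC.
Qed.

Lemma leb_sigma_subadditive (A : (set R)^nat) :
  (leb R (\bigcup_n A n) <= \sum_(n <oo) leb R (A n))%E.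
Proof. exact: (@outer_measure_sigma_subadditive _ _ (wlength idfun)^*%mu). Qed.

Lemma lebE A : leb R A =
  ereal_inf [set (\sum_(k <oo) wlength idfun (I k))%E | I in
    @measurable_cover _ (ocitv_type R) A].
Proof. by []. Qed.

Let leb_affine_le r b A : r != 0 ->
  (leb R (affine r b @^-1` A) <= `|r|^-1%:E * leb R A)%E.
Proof.
move=> r0; have rV0 : (0 < `|r|^-1)%R by rewrite invr_gt0 normr_gt0.
rewrite -lee_pdivrMl// [X in (_ <= X)%E]lebE.
apply: le_ereal_inf_tmp => _ [I [mI AI] <-].
rewrite lee_pdivrMl//.
rewrite -nneseriesZl//.
apply: (@le_trans _ _ (leb R (\bigcup_n (affine r b @^-1` I n)))).
  by apply: leb_mono => x /= /AI[k _ Ik]; exists k.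
apply: le_trans (leb_sigma_subadditive _) _.
apply: lee_nneseries => [n _ _|n _]; first exact: measure_ge0.
have /ocitvP[->|[[x y] /= xy ->]] : ocitv (I n) by exact: mI.
  by rewrite preimage_set0 wlength0 mule0 measure0.
by rewrite affine_itvoc// wlength_itv /= lte_fin xy -EFinB -EFinM.
Qed.

(** The set [A] is arbitrary: a cover of [A] by intervals is pulled back to a
    cover of the preimage, and the reverse inequality is the same statement for
    the inverse map. Measurability of preimages then follows from the criterion
    of Caratheodory. *)
Lemma leb_affine r b A : r != 0 ->
  leb R (affine r b @^-1` A) = (`|r|^-1%:E * leb R A)%E.
Proof.
move=> r0; apply/eqP; rewrite eq_le leb_affine_le//=.
have rV0 : (0 < `|r|^-1)%R by rewrite invr_gt0 normr_gt0.
rewrite -lee_pdivlMl//.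
have /(leb_affine_le (- (r^-1 * b)) (affine r b @^-1` A)) : r^-1 != 0.
  by rewrite invr_eq0.
rewrite normfV -comp_preimage (_ : _ \o _ = id) ?preimage_id//.
by apply/funext => x /=; rewrite affineVK.
Qed.

Lemma measurable_lebP A : measurable (A : set (lebR R)) <->
  (forall B : set R, leb R B = leb R (B `&` A) + leb R (B `&` ~` A))%E.
Proof. by []. Qed.

Lemma measurable_affine_preimage r b A : r != 0 ->
  measurable (A : set (lebR R)) ->
  measurable (affine r b @^-1` A : set (lebR R)).
Proof.
move=> r0 /measurable_lebP mA; apply/measurable_lebP => X.
have XE B : leb R (X `&` affine r b @^-1` B) =
    (`|r|^-1%:E * leb R ((affine r^-1 (- (r^-1 * b)) @^-1` X) `&` B))%E.
  rewrite -(leb_affine b _ r0) preimage_setI -comp_preimage.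
  rewrite (_ : affine r^-1 _ \o affine r b = id) ?preimage_id//.
  by apply/funext => x /=; rewrite affineK.
have := XE setT; rewrite preimage_setT !setIT => ->.
rewrite preimage_setC !XE -ge0_muleDr ?measure_ge0//.
by congr (_ * _)%E; exact: mA.
Qed.

Lemma measurable_affine r b : r != 0 ->
  measurable_fun [set: lebR R] (affine r b : lebR R -> lebR R).
Proof.
by move=> r0 _ B mB; rewrite setTI; exact: measurable_affine_preimage.
Qed.

Lemma ge0_integral_affine r b (A : set R) (g : lebR R -> \bar R) : r != 0 ->
  measurable (A : set (lebR R)) ->
  measurable_fun (A : set (lebR R)) g -> (forall x, A x -> 0 <= g x)%E ->
  (\int[leb R]_(x in affine r b @^-1` A) g (affine r b x) =
  `|r|^-1%:E * \int[leb R]_(x in A) g x)%E.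
Proof.
move=> r0 mA mg g0.
have rV0 : (0 <= `|r|^-1)%R by rewrite invr_ge0.
rewrite -(@ge0_integral_pushforward _ _ _ _ _ _ (measurable_affine b r0)
  (leb R) A g)//; last by move=> x; rewrite inE; exact: g0.
rewrite (eq_measure_integral (mscale (NngNum rV0) (leb R))).
  by rewrite ge0_integral_mscale.
- exact: measurable_affine.
- by move=> ? B _ _; exact: leb_affine.
Qed.

Lemma ae_affine r b (P : R -> Prop) : r != 0 ->
  {ae leb R, forall x, P x} -> {ae leb R, forall x, P (affine r b x)}.
Proof.
move=> r0 [N [mN N0 NP]]; exists (affine r b @^-1` N); split.
- exact: measurable_affine_preimage.
- by apply: eq_trans (leb_affine b N r0) _; rewrite [X in (_ * X)%E]N0 mule0.
- by move=> x /= nP; apply: NP.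
Qed.

Lemma ae_leb_imp (P Q : R -> Prop) : (forall x, P x -> Q x) ->
  {ae leb R, forall x, P x} -> {ae leb R, forall x, Q x}.
Proof.
move=> PQ [N [mN N0 NP]]; exists N; split=> // x /= nQ; apply: NP => /= Px.
by apply: nQ; exact: PQ.
Qed.

Lemma ae_leb_imp2 (P Q S : R -> Prop) : (forall x, P x -> Q x -> S x) ->
  {ae leb R, forall x, P x} -> {ae leb R, forall x, Q x} ->
  {ae leb R, forall x, S x}.
Proof.
move=> PQS [N [mN N0 NP]] [M [mM M0 MQ]]; exists (N `|` M); split.
- exact: measurableU.
- exact: null_set_setU.
- move=> x /= nS; have [Px|nP] := pselect (P x); last by left; exact: NP.
  by right; apply: MQ => /= Qx; apply: nS; exact: PQS.
Qed.

Lemma ae_lebT (P : R -> Prop) : (forall x, P x) -> {ae leb R, forall x, P x}.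
Proof.
move=> HP; exists set0; split=> // x /= nP; exact: nP.
Qed.

End LebesgueBasics.

(** * Integrals of nonnegative functions *)

(** The integral of a nonnegative function is the supremum of the integrals of
    the simple functions below it, so it is monotone on all functions. This
    generality matters because the modular in the hypothesis on [psi] may have
    a non-measurable integrand. *)
Lemma ge0_le_integral_nonmeas d (T : measurableType d) (R : realType)
    (mu : {measure set T -> \bar R}) (D : set T) (f g : T -> \bar R) :
  (forall x, D x -> 0 <= f x)%E -> (forall x, D x -> f x <= g x)%E ->
  (\int[mu]_(x in D) f x <= \int[mu]_(x in D) g x)%E.
Proof.
move=> f0 fg; rewrite !ge0_integralE//; last first.
  by move=> x Dx; exact: le_trans (f0 _ Dx) (fg _ Dx).
apply: ge_ereal_sup => _ [h hf <-]; apply: ereal_sup_ubound; exists h => //= x.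
apply: le_trans (hf x) _; rewrite !patchE; case: ifPn => // xD.
by apply: fg; exact: set_mem.
Qed.

Notation lmeas u := (measurable_fun [set: lebR _] (u : lebR _ -> _)).

Section RealIntegrals.
Context {R : realType}.
Implicit Types u v : R -> R.

Lemma lmeas_EFin u : lmeas u -> lmeas (fun x => (u x)%:E).
Proof. exact: (measurableT_comp (@EFin_measurable R setT)). Qed.

Lemma lmeas_cst (c : R) : lmeas (fun _ : R => c).
Proof. exact: measurable_cst. Qed.

Lemma lmeasD u v : lmeas u -> lmeas v -> lmeas (fun x => u x + v x).
Proof. exact: measurable_funD. Qed.

Lemma lmeasB u v : lmeas u -> lmeas v -> lmeas (fun x => u x - v x).
Proof. exact: measurable_funB. Qed.

Lemma lmeasM u v : lmeas u -> lmeas v -> lmeas (fun x => u x * v x).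
Proof. exact: measurable_funM. Qed.

Lemma lmeas_norm u : lmeas u -> lmeas (fun x => `|u x|).
Proof. exact: (measurableT_comp (@normr_measurable R setT)). Qed.

Lemma lmeas_affine d (T : measurableType d) (u : R -> T) r b :
  r != 0 -> lmeas u -> lmeas (u \o affine r b).
Proof. by move=> r0 mu; exact: (measurableT_comp mu (measurable_affine b r0)). Qed.

Lemma lmeas_indic (A : set R) : measurable (A : set (lebR R)) ->
  lmeas (\1_A : R -> R).
Proof. exact: (@measurable_indic _ (lebR R)). Qed.

Lemma lintegralD u v : lmeas u -> lmeas v ->
  (forall x, 0 <= u x) -> (forall x, 0 <= v x) ->
  (\int[leb R]_x (u x + v x)%:E =
   \int[leb R]_x (u x)%:E + \int[leb R]_x (v x)%:E)%E.
Proof.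
move=> mu mv u0 v0; exact: (ge0_integralD (leb R) measurableT
  (fun x _ => u0 x : (0 <= (u x)%:E)%E) (lmeas_EFin mu)
  (fun x _ => v0 x : (0 <= (v x)%:E)%E) (lmeas_EFin mv)).
Qed.

Lemma lintegralZ (c : R) u : 0 <= c -> lmeas u -> (forall x, 0 <= u x) ->
  (\int[leb R]_x (c * u x)%:E = c%:E * \int[leb R]_x (u x)%:E)%E.
Proof.
move=> c0 mu u0; exact: (ge0_integralZl_EFin (leb R) measurableT
  (fun x _ => u0 x : (0 <= (u x)%:E)%E) (lmeas_EFin mu) c0).
Qed.

Lemma lintegral_le u v : (forall x, 0 <= u x) -> (forall x, u x <= v x) ->
  (\int[leb R]_x (u x)%:E <= \int[leb R]_x (v x)%:E)%E.
Proof.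
by move=> u0 uv; apply: ge0_le_integral_nonmeas => x _; rewrite lee_fin.
Qed.

Lemma lintegral_ge0 u : (forall x, 0 <= u x) -> (0 <= \int[leb R]_x (u x)%:E)%E.
Proof. by move=> u0; apply: integral_ge0 => x _; rewrite lee_fin. Qed.

Lemma lintegral_shift u b : lmeas u -> (forall x, 0 <= u x) ->
  (\int[leb R]_x (u (affine 1 b x))%:E = \int[leb R]_x (u x)%:E)%E.
Proof.
move=> mu u0; have := @ge0_integral_affine R 1 b setT (fun x => (u x)%:E)
  (oner_neq0 R) measurableT (lmeas_EFin mu) (fun x _ => u0 x : (0 <= (u x)%:E)%E).
by rewrite preimage_setT normr1 invr1 mul1e.
Qed.

Lemma lintegral_indic (A : set R) : measurable (A : set (lebR R)) ->
  (\int[leb R]_x (\1_A x : R)%:E = leb R A)%E.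
Proof. by move=> mA; rewrite integral_indic// setIT. Qed.

Lemma elintegralD (D : set R) (u v : R -> \bar R) :
  measurable (D : set (lebR R)) ->
  measurable_fun (D : set (lebR R)) u -> measurable_fun (D : set (lebR R)) v ->
  (forall x, D x -> 0 <= u x)%E -> (forall x, D x -> 0 <= v x)%E ->
  (\int[leb R]_(x in D) (u x + v x) =
   \int[leb R]_(x in D) u x + \int[leb R]_(x in D) v x)%E.
Proof.
by move=> mD mu mv u0 v0; exact: (ge0_integralD (leb R) mD u0 mu v0 mv).
Qed.

Lemma elintegralZ (D : set R) (u : R -> \bar R) (c : R) :
  measurable (D : set (lebR R)) ->
  measurable_fun (D : set (lebR R)) u ->
  (forall x, D x -> 0 <= u x)%E -> 0 <= c ->
  (\int[leb R]_(x in D) (c%:E * u x) = c%:E * \int[leb R]_(x in D) u x)%E.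
Proof.
by move=> mD mu u0 c0; exact: (ge0_integralZl_EFin (leb R) mD u0 mu c0).
Qed.

Lemma lmeas_series (u : nat -> R -> \bar R) : (forall k, lmeas (u k)) ->
  (forall k x, 0 <= u k x)%E -> lmeas (fun x => \sum_(k <oo) u k x)%E.
Proof.
move=> mu u0.
exact: (@ge0_emeasurable_sum _ (lebR R) R setT u xpredT
  (fun k x _ _ => u0 k x) (fun k _ => mu k)).
Qed.

Lemma lintegral_series (u : nat -> R -> \bar R) : (forall k, lmeas (u k)) ->
  (forall k x, 0 <= u k x)%E ->
  (\int[leb R]_x (\sum_(k <oo) u k x) = \sum_(k <oo) \int[leb R]_x u k x)%E.
Proof.
move=> mu u0; exact: (integral_nneseries (leb R) measurableT mu (fun k x _ => u0 k x)).
Qed.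

End RealIntegrals.

(** * The real-valued norm *)

Section Rnorm.
Context {R : realType} {X : normedModType R[i]}.
Implicit Types (x y : X) (u : nat -> X).

Lemma rnormE x : `|x| = (rnorm x)%:C.
Proof. by rewrite RRe_real// ger0_real. Qed.

Lemma rnorm_ge0 x : 0 <= rnorm x.
Proof. by rewrite -ler0c -rnormE. Qed.

Lemma rnorm0 : rnorm (0 : X) = 0.
Proof. by rewrite /rnorm normr0. Qed.

Lemma rnormN x : rnorm (- x) = rnorm x.
Proof. by rewrite /rnorm normrN. Qed.

Lemma rnorm_distC x y : rnorm (x - y) = rnorm (y - x).
Proof. by rewrite -rnormN opprB. Qed.

Lemma ler_rnormD x y : rnorm (x + y) <= rnorm x + rnorm y.
Proof. by rewrite -lecR rmorphD /= -!rnormE ler_normD. Qed.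

Lemma ler_rnormB x y : rnorm (x - y) <= rnorm x + rnorm y.
Proof. by rewrite -(rnormN y) ler_rnormD. Qed.

Lemma ler_rnorm_dist z x y : rnorm (x - y) <= rnorm (x - z) + rnorm (z - y).
Proof. by rewrite -[x - y](subrKA z) ler_rnormD. Qed.

Lemma ler_rnorm_norm x y : `|rnorm x - rnorm y| <= rnorm (x - y).
Proof.
rewrite ler_norml lerBlDr lerNl opprB lerBlDr; apply/andP; split.
  by rewrite rnorm_distC -[X in rnorm X <= _](subrK x y) ler_rnormD.
by rewrite -[X in rnorm X <= _](subrK y x) ler_rnormD.
Qed.

Lemma rnormZ c x : rnorm (c *: x) = cabs c * rnorm x.
Proof.
by apply: complexI; rewrite rmorphM /= -!rnormE normrZ /cabs RRe_real// ger0_real.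
Qed.

Lemma cabs_ge0 (c : R[i]) : 0 <= cabs c.
Proof. by rewrite -ler0c RRe_real// ger0_real. Qed.

Lemma cabs_real (r : R) : cabs r%:C = `|r|.
Proof. by rewrite /cabs normc_def /= expr0n /= addr0 sqrtr_sqr. Qed.

Lemma cabsE (c : R[i]) : cabs c = Num.sqrt (complex.Re c ^+ 2 + complex.Im c ^+ 2).
Proof. by rewrite /cabs normc_def. Qed.

Lemma Re_le_cabs (c : R[i]) : `|complex.Re c| <= cabs c.
Proof. by rewrite cabsE -[leLHS]sqrtr_sqr ler_wsqrtr// lerDl sqr_ge0. Qed.

Lemma Im_le_cabs (c : R[i]) : `|complex.Im c| <= cabs c.
Proof. by rewrite cabsE -[leLHS]sqrtr_sqr ler_wsqrtr// lerDr sqr_ge0. Qed.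

Lemma cabs_le_ReIm (c : R[i]) : cabs c <= `|complex.Re c| + `|complex.Im c|.
Proof.
rewrite cabsE -[leRHS]ger0_norm ?addr_ge0// -[leRHS]sqrtr_sqr ler_wsqrtr//.
rewrite sqrrD !real_normK ?num_real// addrAC lerDl mulrn_wge0// mulr_ge0//.
Qed.

Lemma rnorm_sum (I : Type) (r : seq I) (P : pred I) (F : I -> X) :
  rnorm (\sum_(i <- r | P i) F i) <= \sum_(i <- r | P i) rnorm (F i).
Proof.
elim/big_ind2: _ => //; first by rewrite rnorm0.
by move=> x1 x2 y1 y2 h1 h2; apply: le_trans (ler_rnormD _ _) (lerD _ _).
Qed.

(** The radii of balls of [X] are elements of [R[i]]; being positive they are
    real, which brings convergence in [X] back to convergence in [R]. *)
Lemma cvg_rnorm u x :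
  u @ \oo --> x <-> (fun n => rnorm (u n - x)) @ \oo --> (0 : R).
Proof.
split=> [/cvgrPdist_lt ux|/cvgrPdist_lt ux]; apply/cvgrPdist_lt => e e0.
  have /ux : 0 < e%:C by rewrite ltcR.
  apply: filterS => n; rewrite rnormE ltcR sub0r normrN ger0_norm ?rnorm_ge0//.
  by rewrite rnorm_distC.
have eE : e = (complex.Re e)%:C by rewrite RRe_real// gtr0_real.
rewrite eE; have /ux : 0 < complex.Re e by rewrite -ltcR -eE.
apply: filterS => n; rewrite sub0r normrN ger0_norm ?rnorm_ge0//.
by rewrite rnormE ltcR rnorm_distC.
Qed.

End Rnorm.

Lemma cauchy_rnorm {R : realType} {X : completeNormedModType R[i]}
    (u : nat -> X) (d : nat -> R) :
  d @ \oo --> (0 : R) ->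
  (forall n m, rnorm (u n - u m) <= d n + d m) ->
  exists x : X, u @ \oo --> x.
Proof.
move=> d0 ud; suff cu : cvg (u @ \oo) by exists (lim (u @ \oo : set_system X)).
apply: cauchy_cvg; apply: cauchy_exP => e e0.
have eE : e = (complex.Re e)%:C by rewrite RRe_real// gtr0_real.
have {}e0 : 0 < complex.Re e / 2 by rewrite divr_gt0// -ltcR -eE.
have /cvgrPdist_lt/(_ _ e0) [N _ Nd] := d0.
exists (u N); exists N => //= n /= Nn; rewrite -ball_normE /= eE rnormE ltcR.
apply: (le_lt_trans (ud _ _)).
have := Nd _ (leqnn N); have := Nd _ Nn; rewrite /= !sub0r !normrN => dn dN.
rewrite [ltRHS]splitr ltrD//; exact: le_lt_trans (ler_norm _) _.
Qed.

(** Simple functions with values in an arbitrary type; this makes pairs of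
    simple functions simple, and every function of a simple function simple. *)
Definition simple_map {R : realType} {W : Type} (h : R -> W) :=
  finite_set (range h) /\
  forall w, measurable (h @^-1` [set w] : set (lebR R)).

Section SimpleMap.
Context {R : realType}.

Lemma simple_map_preimage {W : Type} (h : R -> W) (B : set W) :
  simple_map h -> measurable (h @^-1` B : set (lebR R)).
Proof.
move=> [fh mh].
rewrite (_ : _ @^-1` _ = \bigcup_(w in range h `&` B) h @^-1` [set w]).
  by apply: fin_bigcup_measurable => //; exact: finite_setIl.
by apply/seteqP; split=> [x Bx|x [w [_ Bw] /= ->]//]; exists (h x).
Qed.

Lemma simple_map_comp {W V : Type} (g : W -> V) (h : R -> W) :
  simple_map h -> simple_map (g \o h).
Proof.
move=> fh; split; last by move=> v; rewrite comp_preimage; exact: simple_map_preimage.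
by have := finite_image g fh.1; rewrite image_comp.
Qed.

Lemma simple_map_pair {W V : Type} (h : R -> W) (k : R -> V) :
  simple_map h -> simple_map k -> simple_map (fun x => (h x, k x)).
Proof.
move=> [fh mh] [fk mk]; split.
  apply: (sub_finite_set _ (finite_setX fh fk)) => _ [x _ <-] /=.
  by split; exists x.
move=> [w v]; rewrite (_ : _ @^-1` _ = h @^-1` [set w] `&` k @^-1` [set v]).
  exact: measurableI.
by apply/seteqP; split=> x /= [] // -> ->.
Qed.

Lemma simple_map_comp2 {W V U : Type} (g : W -> V -> U) (h : R -> W) (k : R -> V) :
  simple_map h -> simple_map k -> simple_map (fun x => g (h x) (k x)).
Proof.
move=> fh fk.
exact: (@simple_map_comp _ _ (fun p => g p.1 p.2) _ (simple_map_pair fh fk)).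
Qed.

Lemma simple_map_bool (A : set R) : measurable (A : set (lebR R)) ->
  simple_map (fun x => `[< A x >] : bool).
Proof.
move=> mA; split; first exact: finite_finset.
move=> [|].
  rewrite (_ : _ @^-1` _ = A)//; apply/seteqP; split=> x /=; first by move/asboolP.
  by move=> ?; exact/asboolP.
rewrite (_ : _ @^-1` _ = ~` A); first exact: measurableC.
apply/seteqP; split=> x /=; first by move/asboolPn.
by move=> ?; exact/asboolPn.
Qed.

Lemma simple_map_affine {W : Type} (h : R -> W) r b : r != 0 ->
  simple_map h -> simple_map (h \o affine r b).
Proof.
move=> r0 [fh mh]; split; first by apply: sub_finite_set fh => _ [x _ <-]; exists (affine r b x).
by move=> w; rewrite comp_preimage; exact: measurable_affine_preimage.
Qed.

End SimpleMap.

(** * The integral of simple functions *)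

Section SimpleIntegral.
Context {R : realType} {X : completeNormedModType R[i]}.

(** The integral of [g \o h], with one term for each value of [h] instead of one
    for each value of [g \o h]. *)
Definition fibre_sum {W : choiceType} (h : R -> W) (g : W -> X) : X :=
  \sum_(w \in range h) (fine (leb R (h @^-1` [set w])))%:C *: g w.

(** This regrouping replaces common refinements of partitions: two simple
    functions [s] and [t] are both functions of the simple map [(s, t)], so that
    their integrals become sums over the same set of values. *)
Lemma simple_integral_comp {W : choiceType} (h : R -> W) (g : W -> X) :
  simple_map h -> (forall w, g w != 0 -> (leb R (h @^-1` [set w]) < +oo)%E) ->
  simple_integral (g \o h) = fibre_sum h g.
Proof.
move=> [fh mh] hoo; rewrite /simple_integral /fibre_sum.
have fgh : finite_set (range (g \o h)).
  by have := finite_image g fh; rewrite image_comp.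
pose c w := (fine (leb R (h @^-1` [set w])))%:C.
transitivity (\sum_(v \in range (g \o h))
    \sum_(w \in range h) if g w == v then c w *: g w else 0).
  apply: eq_fsbigr => v _.
  (* The fibre over 0 may have infinite measure: [fine] is not additive there. *)
  have [->|v0] := eqVneq v 0.
    rewrite scaler0 fsbig1// => w _; case: eqP => // ->; exact: scaler0.
  have -> : (g \o h) @^-1` [set v] =
      \big[setU/set0]_(w \in range h `&` g @^-1` [set v]) h @^-1` [set w].
    rewrite fsbig_setU; last exact: finite_setIl.
    apply/seteqP; split=> [x /= ghx|x [w [_ /= gw] hx]]; first by exists (h x).
    by rewrite /= hx.
  rewrite measure_fsbig//; last 2 first.
  - exact: finite_setIl.
  - apply/trivIsetP => w w' _ _ ww'; apply/seteqP; split=> // x [/= ->].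
    by move/eqP; rewrite (negbTE ww').
  have fI : finite_set (range h `&` g @^-1` [set v]) by exact: finite_setIl.
  have -> : (\sum_(w \in range h `&` g @^-1` [set v]) leb R (h @^-1` [set w]) =
      (\sum_(w \in range h `&` g @^-1` [set v])
        fine (leb R (h @^-1` [set w])))%:E)%E.
    rewrite -fsumEFin//; apply: eq_fsbigr => w; rewrite inE => -[_ /= gw].
    by rewrite fineK// ge0_fin_numE// hoo// gw.
  rewrite /= fsbig_finite// rmorph_sum scaler_suml.
  transitivity (\sum_(w \in range h `&` g @^-1` [set v]) c w *: g w).
    rewrite [RHS]fsbig_finite// big_seq [RHS]big_seq; apply: eq_bigr => w.
    by rewrite in_fset_set// inE => -[_ /= <-].
  rewrite fsbig_mkcondr; apply: eq_fsbigr => w _; congr (if _ then _ else _).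
  by apply/idP/idP; rewrite ?inE /= => /eqP.
rewrite exchange_fsbig//; apply: eq_fsbigr => w; rewrite inE => -[x _ hx].
rewrite (fsbigD1 (g w))//; last by exists x => //=; rewrite hx.
rewrite eqxx fsbig1 => [|v [_ /= vgw]]; first exact: addr0.
by case: eqP => // gv; case: vgw; rewrite gv.
Qed.

Lemma integral_rnorm_comp {W : choiceType} (h : R -> W) (g : W -> X) :
  simple_map h ->
  (\int[leb R]_x (rnorm (g (h x)))%:E =
   \sum_(w \in range h) (rnorm (g w))%:E * leb R (h @^-1` [set w]))%E.
Proof.
move=> [fh mh].
pose one w x := ((rnorm (g w))%:E * (\1_(h @^-1` [set w]) x : R)%:E)%E.
have mone w : lmeas (one w).
  apply: measurable_funeM; exact/lmeas_EFin/lmeas_indic.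
have one0 w x : (0 <= one w x)%E by rewrite mule_ge0// lee_fin rnorm_ge0.
transitivity (\int[leb R]_x \sum_(w \in range h) one w x)%E.
  apply: eq_integral => x _; rewrite (fsbigD1 (h x))// fsbig1 => [|w [_ /= wh]].
    by rewrite /one indicE mem_set// mule1; exact/esym/adde0.
  by rewrite /one indicE memNset ?mule0// => /= hw; apply: wh.
rewrite (ge0_integral_fsum (leb R) measurableT mone (fun w x _ => one0 w x) fh).
apply: eq_fsbigr => w _.
rewrite (elintegralZ measurableT (lmeas_EFin (lmeas_indic (mh w))) _ (rnorm_ge0 _)).
  by rewrite lintegral_indic.
by move=> x _; rewrite lee_fin.
Qed.

Lemma rnorm_fibre_sum {W : choiceType} (h : R -> W) (g : W -> X) :
  simple_map h ->
  ((rnorm (fibre_sum h g))%:E <= \int[leb R]_x (rnorm (g (h x)))%:E)%E.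
Proof.
move=> hm; rewrite integral_rnorm_comp// /fibre_sum; case: hm => fh mh.
rewrite !fsbig_finite//.
apply: (@le_trans _ _ (\sum_(w <- finmap.enum_fset (fset_set (range h)))
    (rnorm (g w) * fine (leb R (h @^-1` [set w])))%:E)%E).
  rewrite sumEFin lee_fin; apply: le_trans (rnorm_sum _ _ _) _.
  apply: ler_sum => w _; rewrite rnormZ cabs_real mulrC ger0_norm//.
apply: lee_sum => w _; rewrite EFinM; apply: lee_pmul => //.
- exact: rnorm_ge0.
- suff H (m : \bar R) : (0 <= m -> (fine m)%:E <= m)%E by exact/H/measure_ge0.
  by case: m => //= _; exact: leey.
Qed.

Lemma rnorm_simple_integralB (s t : R -> X) :
  integrable_simple s -> integrable_simple t ->
  ((rnorm (simple_integral s - simple_integral t))%:E <=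
   \int[leb R]_x (rnorm (s x - t x))%:E)%E.
Proof.
move=> [ss soo] [st too]; pose h x := (s x, t x).
have fh : simple_map h by exact: simple_map_pair.
have -> : simple_integral s = fibre_sum h fst.
  rewrite -simple_integral_comp// => -[v w] /= v0.
  by apply: le_lt_trans (soo _ v0); apply: leb_mono => x [].
have -> : simple_integral t = fibre_sum h snd.
  rewrite -simple_integral_comp// => -[v w] /= w0.
  by apply: le_lt_trans (too _ w0); apply: leb_mono => x [].
have -> : fibre_sum h fst - fibre_sum h snd = fibre_sum h (fun p => p.1 - p.2).
  case: fh => fh _; rewrite /fibre_sum !fsbig_finite// -sumrB.
  by apply: eq_bigr => w _; rewrite scalerBr.
exact: (rnorm_fibre_sum (fun p => p.1 - p.2) fh).
Qed.

Lemma simple_integral0 : simple_integral (fun=> 0 : X) = 0.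
Proof. by rewrite /simple_integral fsbig1// => _ [x _ <-]; rewrite scaler0. Qed.

Lemma simple_integral_shift (s : R -> X) b :
  simple_integral (s \o affine 1 b) = simple_integral s.
Proof.
rewrite /simple_integral.
have -> : range (s \o affine 1 b) = range s.
  apply/seteqP; split=> _ [x _ <-]; first by exists (affine 1 b x).
  exists (x - b) => //=; congr s; rewrite /affine; ring.
apply: eq_fsbigr => v _; congr ((fine _)%:C *: _).
by rewrite comp_preimage leb_affine ?oner_neq0// normr1 invr1 mul1e.
Qed.

End SimpleIntegral.

(** * Strongly measurable functions *)

Lemma measurable_simple_map {R : realType} d (T : measurableType d) (h : R -> T) :
  simple_map h -> measurable_fun [set: lebR R] (h : lebR R -> T).
Proof. by move=> fh _ B _; rewrite setTI; exact: simple_map_preimage. Qed.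

Import HBSimple.

Lemma simple_map_approx {R : realType} (u : R -> R) :
  measurable_fun [set: lebR R] (u : lebR R -> R) ->
  exists g : nat -> R -> R, (forall n, simple_map (g n)) /\
    forall x, g n x @[n --> \oo] --> u x.
Proof.
move=> mu.
have mu' : measurable_fun [set: lebR R] (EFin \o (u : lebR R -> R)).
  exact/measurable_EFinP.
have [g gu] := approximation_sfun measurableT mu'.
exists (fun n => (g n : lebR R -> R)); split=> [n|x].
  split; first exact: (@fimfunP _ _ (g n)).
  by move=> w; exact: (measurable_sfunP (g n)).
by have /fine_cvg := gu x I.
Qed.

Section StronglyMeasurable.
Context {R : realType} {X : completeNormedModType R[i]}.
Implicit Types (f g s : R -> X).

Lemma strongly_measurable_simple s : simple_function s -> strongly_measurable s.
Proof.
by move=> ss; exists (fun=> s); split=> //; apply: ae_lebT => x; exact: cvg_cst.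
Qed.

Lemma strongly_measurableB f g :
  strongly_measurable f -> strongly_measurable g ->
  strongly_measurable (fun x => f x - g x).
Proof.
move=> [s [ss sf]] [t [st tg]]; exists (fun n x => s n x - t n x); split.
  by move=> n; exact: (simple_map_comp2 (fun a b : X => a - b) (ss n) (st n)).
by apply: ae_leb_imp2 sf tg => x sx tx; exact: (cvgB sx tx).
Qed.

Lemma strongly_measurable_affine f r b : r != 0 ->
  strongly_measurable f -> strongly_measurable (f \o affine r b).
Proof.
move=> r0 [s [ss sf]]; exists (fun n => s n \o affine r b); split.
  by move=> n; exact: (simple_map_affine b r0 (ss n)).
exact: (@ae_affine R r b (fun x => s n x @[n --> \oo] --> f x) r0 sf).
Qed.

(** Only almost everywhere a limit of measurable functions: this uses that the
    Lebesgue measure is complete. *)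
Lemma measurable_rnorm f : strongly_measurable f ->
  measurable_fun [set: lebR R] (fun x : lebR R => rnorm (f x)).
Proof.
move=> [s [ss sf]]; apply/measurable_EFinP.
pose l (x : lebR R) := limn_esup (fun n => (rnorm (s n x))%:E).
apply: (ae_measurable_fun completed_lebesgue_measure_is_complete (f := l)); last first.
  apply: measurable_fun_limn_esup => n.
  apply/measurable_EFinP; apply: measurable_simple_map.
  exact: (simple_map_comp (fun v : X => rnorm v) (ss n)).
apply: ae_leb_imp sf => x /cvg_rnorm sfx _; rewrite /l.
apply: (cvg_limn_einf_sup _).2; apply: cvg_EFin; first exact: nearW.
apply: cvg_trans (_ : rnorm (s n x) @[n --> \oo] --> _) => //.
apply/cvgrPdist_lt => e e0; have /cvgrPdist_lt/(_ _ e0) := sfx.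
apply: filterS => n; rewrite sub0r normrN ger0_norm ?rnorm_ge0//.
by apply: le_lt_trans; rewrite distrC ler_rnorm_norm.
Qed.

(** If [g n] are finitely valued and tend to the identity of [R], then [f \o g n]
    are finitely valued and tend to [f]. *)
Lemma strongly_measurable_continuous f :
  (forall (x : R) (e : R), 0 < e -> exists2 d : R, 0 < d &
     forall y : R, `|y - x| < d -> rnorm (f y - f x) < e) ->
  strongly_measurable f.
Proof.
move=> fc; have [g [fg gx]] := simple_map_approx (@measurable_leb_id R).
exists (fun n => f \o g n); split; first by move=> n; exact: simple_map_comp.
apply: ae_lebT => x; apply/cvg_rnorm/cvgrPdist_lt => e /fc -/(_ x)[d d0 fxd].
have /cvgrPdist_lt/(_ _ d0) := gx x.
apply: filterS => n xd; rewrite sub0r normrN ger0_norm ?rnorm_ge0//.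
by apply: fxd; rewrite distrC.
Qed.

Lemma strongly_measurableZ (psi : R -> R[i]) f :
  measurable_fun [set: lebR R] (fun x : lebR R => complex.Re (psi x)) ->
  measurable_fun [set: lebR R] (fun x : lebR R => complex.Im (psi x)) ->
  strongly_measurable f -> strongly_measurable (fun x => psi x *: f x).
Proof.
move=> /simple_map_approx[a [fa ax]] /simple_map_approx[b [fb bx]] [s [ss sf]].
exists (fun n x => (a n x +i* b n x) *: s n x); split.
  move=> n; apply: (simple_map_comp2 (fun (c : R[i]) v => c *: v)); last exact: ss.
  exact: (simple_map_comp2 (fun c d : R => c +i* d)).
apply: ae_leb_imp sf => x /cvg_rnorm sfx; apply/cvg_rnorm.
have [M M0 HM] : exists2 M, 0 < M & \forall n \near \oo, rnorm (s n x) <= M.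
  exists (rnorm (f x) + 1); first by rewrite ltr_wpDl// rnorm_ge0.
  have /cvgrPdist_lt/(_ _ ltr01) := sfx; apply: filterS => n.
  rewrite sub0r normrN ger0_norm ?rnorm_ge0// => h.
  by rewrite -[s n x](subrK (f x)) addrC; apply: le_trans (ler_rnormD _ _) _;
    rewrite lerD2l ltW.
apply: (@squeeze_cvgr _ _ _ _ (fun=> 0)
  (fun n => (`|a n x - complex.Re (psi x)| + `|b n x - complex.Im (psi x)|) * M
    + cabs (psi x) * rnorm (s n x - f x))).
- apply: filterS HM => n hM; rewrite rnorm_ge0/=.
  rewrite [X in rnorm X <= _](_ : _ = ((a n x +i* b n x) - psi x) *: s n x
    + psi x *: (s n x - f x)).
    apply: le_trans (ler_rnormD _ _) _; rewrite !rnormZ lerD2r.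
    apply: ler_pM => //; rewrite ?cabs_ge0 ?rnorm_ge0//.
    by apply: le_trans (cabs_le_ReIm _) _; case: (psi x).
  by rewrite scalerBl scalerBr addrA subrK.
- exact: cvg_cst.
- have cvg0 (u : nat -> R) v : u @ \oo --> v ->
      (fun n => `|u n - v|) @ \oo --> (0 : R).
    move=> uv; apply/cvgrPdist_lt => e e0.
    have /cvgrPdist_lt/(_ _ e0) := uv; apply: filterS => n.
    by rewrite sub0r normrN normr_id distrC.
  have := cvgD (cvgM (cvgD (cvg0 _ _ (ax x)) (cvg0 _ _ (bx x))) (cvg_cst M))
    (cvgM (cvg_cst (cabs (psi x))) sfx).
  by rewrite addr0 mul0r mulr0 addr0; apply.
Qed.

End StronglyMeasurable.

(** * Comparison of Bochner integrals *)

Section BochnerTheory.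
Context {R : realType} {X : completeNormedModType R[i]}.
Implicit Types (f g h s : R -> X).

Lemma ge0_integral_rnorm f : (0 <= \int[leb R]_x (rnorm (f x))%:E)%E.
Proof. by apply: integral_ge0 => x _; rewrite lee_fin rnorm_ge0. Qed.

Lemma integral_rnorm_triangle f g h :
  strongly_measurable f -> strongly_measurable g -> strongly_measurable h ->
  (\int[leb R]_x (rnorm (f x - g x))%:E <=
   \int[leb R]_x (rnorm (f x - h x))%:E + \int[leb R]_x (rnorm (h x - g x))%:E)%E.
Proof.
move=> mf mg mh.
rewrite -(lintegralD (measurable_rnorm (strongly_measurableB mf mh))
  (measurable_rnorm (strongly_measurableB mh mg)) (fun x => rnorm_ge0 _)
  (fun x => rnorm_ge0 _)).
by apply: lintegral_le => x; [exact: rnorm_ge0|exact: ler_rnorm_dist].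
Qed.

Lemma integral_rnormC f g :
  (\int[leb R]_x (rnorm (f x - g x))%:E = \int[leb R]_x (rnorm (g x - f x))%:E)%E.
Proof. by apply: eq_integral => x _; rewrite rnorm_distC. Qed.

(** All that is needed of the Bochner integral besides its existence: taking
    [g = 0] it bounds the norm of an integral, and it compares the values of the
    convolution at two points without using linearity. *)
Lemma rnorm_bochner_integralB f g J K :
  is_bochner_integral f J -> is_bochner_integral g K ->
  ((rnorm (J - K))%:E <= \int[leb R]_x (rnorm (f x - g x))%:E)%E.
Proof.
move=> [mf [s [ss sf /cvg_rnorm sJ]]] [mg [t [st tg /cvg_rnorm tK]]].
apply/lee_addgt0Pr => e e0.
have e4 : 0 < e / 4 by rewrite divr_gt0.
have /cvgrPdist_lt/(_ _ e4) hJ := sJ.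
have /cvgrPdist_lt/(_ _ e4) hK := tK.
have small (u : (\bar R)^nat) : (forall n, 0 <= u n)%E -> u @ \oo --> 0%E ->
    \forall n \near \oo, (u n <= (e / 4)%:E)%E.
  move=> u0 /fine_cvgP[ufin /cvgrPdist_lt/(_ _ e4)]; apply: filterS2 ufin => n fu.
  by rewrite sub0r normrN ger0_norm ?fine_ge0// -lte_fin fineK// => /ltW.
have hf := small _ (fun n => ge0_integral_rnorm _) sf.
have hg := small _ (fun n => ge0_integral_rnorm _) tg.
near \oo => n.
have hJ' : rnorm (J - simple_integral (s n)) <= e / 4.
  near: n; apply: filterS hJ => n.
  by rewrite sub0r normrN ger0_norm ?rnorm_ge0// rnorm_distC => /ltW.
have hK' : rnorm (simple_integral (t n) - K) <= e / 4.
  near: n; apply: filterS hK => n.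
  by rewrite sub0r normrN ger0_norm ?rnorm_ge0// => /ltW.
have hf' : (\int[leb R]_x (rnorm (f x - s n x))%:E <= (e / 4)%:E)%E by near: n.
have hg' : (\int[leb R]_x (rnorm (g x - t n x))%:E <= (e / 4)%:E)%E by near: n.
have msn : strongly_measurable (s n) by exact/strongly_measurable_simple/(ss n).1.
have mtn : strongly_measurable (t n) by exact/strongly_measurable_simple/(st n).1.
apply: (@le_trans _ _ ((e / 4)%:E + ((e / 4)%:E + (rnorm (simple_integral (s n)
    - simple_integral (t n)))%:E))%E).
  rewrite -!EFinD lee_fin.
  apply: le_trans (ler_rnorm_dist (simple_integral (s n)) _ _) (lerD hJ' _).
  rewrite addrC.
  exact: le_trans (ler_rnorm_dist (simple_integral (t n)) _ _) (lerD _ hK').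
have step : ((rnorm (simple_integral (s n) - simple_integral (t n)))%:E <=
    (e / 4)%:E + (\int[leb R]_x (rnorm (f x - g x))%:E + (e / 4)%:E))%E.
  apply: le_trans (rnorm_simple_integralB (ss n) (st n)) _.
  apply: le_trans (integral_rnorm_triangle msn mtn mf) _.
  rewrite integral_rnormC leeD//.
  by apply: le_trans (integral_rnorm_triangle mf mtn mg) _; rewrite leeD.
apply: (@le_trans _ _ _ _ _ (leeD (lexx (e / 4)%:E) (leeD (lexx (e / 4)%:E) step))).
move: (\int[leb R]_x (rnorm (f x - g x))%:E)%E => I.
rewrite (addeC _ (e / 4)%:E) !addeA -!EFinD [leRHS]addeC.
by apply: leeD2r; rewrite lee_fin; lra.
Unshelve. all: by end_near. Qed.

Lemma bochner_integralP f : bochner_integrable f ->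
  is_bochner_integral f (bochner_integral f).
Proof. by move=> [J fJ]; rewrite /bochner_integral; case: xgetP => // /(_ J). Qed.

Lemma is_bochner_integral0 : is_bochner_integral (fun=> 0 : X) 0.
Proof.
have s0 : simple_function (fun _ : R => 0 : X).
  split; first by apply: sub_finite_set (finite_set1 (0 : X)) => _ [x _ <-].
  move=> v; have [->|v0] := eqVneq v 0.
    rewrite (_ : _ @^-1` _ = setT); first exact: measurableT.
    by apply/seteqP; split.
  rewrite (_ : _ @^-1` _ = set0); first exact: measurable0.
  by apply/seteqP; split=> // x /= /esym/eqP; rewrite (negbTE v0).
split; first exact: strongly_measurable_simple.
exists (fun=> fun=> 0); split.
- move=> _; split=> // v v0; rewrite (_ : _ @^-1` _ = set0) ?measure0//.
  by apply/seteqP; split=> // x /= /esym/eqP; rewrite (negbTE v0).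
- rewrite (_ : (fun _ => _) = cst 0%E); first exact: cvg_cst.
  by apply/funext => n; apply: integral0_eq => x _; rewrite subrr rnorm0.
- by rewrite simple_integral0; exact: cvg_cst.
Qed.

Lemma rnorm_bochner_integral f J : is_bochner_integral f J ->
  ((rnorm J)%:E <= \int[leb R]_x (rnorm (f x))%:E)%E.
Proof.
move=> fJ; have := rnorm_bochner_integralB fJ is_bochner_integral0.
by rewrite subr0; under eq_integral do rewrite subr0.
Qed.

Lemma is_bochner_integral_shift f J b :
  is_bochner_integral f J -> is_bochner_integral (f \o affine 1 b) J.
Proof.
move=> [mf [s [ss sf sJ]]]; have o0 := oner_neq0 R.
split; first exact: strongly_measurable_affine.
exists (fun n => s n \o affine 1 b); split.
- move=> n; split; first exact: (simple_map_affine b o0 (ss n).1).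
  move=> v v0; rewrite comp_preimage leb_affine// normr1 invr1 mul1e.
  exact: (ss n).2.
- suff -> : (fun n => (\int[leb R]_x
      (rnorm ((f \o affine 1 b) x - (s n \o affine 1 b) x))%:E)%E) =
    (fun n => (\int[leb R]_x (rnorm (f x - s n x))%:E)%E) by [].
  apply/funext => n.
  have msn := strongly_measurable_simple (ss n).1.
  exact: (lintegral_shift b (measurable_rnorm (strongly_measurableB mf msn))
    (fun x => rnorm_ge0 _)).
- by under eq_fun do rewrite simple_integral_shift.
Qed.

End BochnerTheory.

(** * Existence of Bochner integrals *)

Section BochnerExistence.
Context {R : realType} {X : completeNormedModType R[i]}.
Implicit Types (f g h s : R -> X).

(** The approximating simple functions [s n] are set to 0 outside of [[-n, n]],
    which gives them finite integrals, and where they exceed [2 * rnorm (f x)],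
    which makes [3 * rnorm (f x)] a dominating function. The condition discards
    no tail of the sequence at a point where [f] does not vanish, because [s n x]
    tends to [f x]. Dominated convergence then makes the integrals of the
    truncations a Cauchy sequence. *)
Lemma bochner_integrable_norm f : strongly_measurable f ->
  (\int[leb R]_x (rnorm (f x))%:E < +oo)%E -> bochner_integrable f.
Proof.
move=> mf foo; have [s [ss sf]] := mf.
have mrf : measurable_fun [set: lebR R] (fun x : lebR R => rnorm (f x)).
  exact: measurable_rnorm.
have mcrf c : measurable_fun [set: lebR R] (fun x : lebR R => c * rnorm (f x)).
  exact: (measurable_funM (measurable_cst c) mrf).
pose A n : set R := `[- n%:R, n%:R]%classic `&`
  [set x | rnorm (s n x) <= 2 * rnorm (f x)].
have mA n : measurable (A n : set (lebR R)).
  apply: measurableI; first exact: measurable_leb_itv.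
  have : measurable_fun [set: lebR R]
      (fun x : lebR R => rnorm (s n x) <= 2 * rnorm (f x)).
    apply: (measurable_fun_ler _ (mcrf 2)).
    exact: (measurable_rnorm (strongly_measurable_simple (ss n))).
  move=> /(_ measurableT [set true]); rewrite setTI; exact.
pose t n x : X := if `[< A n x >] then s n x else 0.
have st n : simple_function (t n).
  exact: (simple_map_comp2 (fun (b : bool) v => if b then v else 0)
    (simple_map_bool (mA n)) (ss n)).
have it n : integrable_simple (t n).
  split=> // v v0; apply: (@le_lt_trans _ _ (leb R `[- n%:R, n%:R]%classic)).
    apply: leb_mono => x; rewrite /t /=; case: asboolP => [[]//|_ /esym/eqP].
    by rewrite (negbTE v0).
  by rewrite leb_itv; case: ifP => _; rewrite ltry.
have bound n x : rnorm (f x - t n x) <= 3 * rnorm (f x).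
  rewrite /t; case: asboolP => [[_ /= sx]|_].
    by apply: le_trans (ler_rnormB _ _) _; lra.
  by rewrite subr0; have := rnorm_ge0 (f x); lra.
have mft n : measurable_fun [set: lebR R] (fun x : lebR R => (rnorm (f x - t n x))%:E).
  apply/measurable_EFinP/measurable_rnorm/strongly_measurableB => //.
  exact: strongly_measurable_simple.
have int3 : (\int[leb R]_x (3 * rnorm (f x))%:E < +oo)%E.
  under eq_integral do rewrite EFinM.
  have rf0 (x : lebR R) : [set: lebR R] x -> (0 <= (rnorm (f x))%:E)%E.
    by move=> _; rewrite lee_fin rnorm_ge0.
  have mEf := measurableT_comp (@EFin_measurable R setT) mrf.
  rewrite (ge0_integralZl_EFin (leb R) measurableT rf0 mEf (ler0n R 3)).
  by rewrite lte_mul_pinfty.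
have cvg0 : (\int[leb R]_x (rnorm (f x - t n x))%:E)%E @[n --> \oo] --> 0%E.
  have i3 : (leb R).-integrable setT (fun x : lebR R => (3 * rnorm (f x))%:E).
    apply/integrableP; split.
      exact: (measurableT_comp (@EFin_measurable R setT) (mcrf 3)).
    by under eq_integral do rewrite gee0_abs ?lee_fin ?mulr_ge0 ?rnorm_ge0//.
  have [] := @dominated_convergence _ (lebR R) R (leb R) setT measurableT
    (fun n x => (rnorm (f x - t n x))%:E) (cst 0%E) (fun x => (3 * rnorm (f x))%:E)
    mft (measurable_cst _) _ i3.
  - apply: ae_leb_imp sf => x /cvg_rnorm sfx _.
    have [fx0|fx0] := eqVneq (rnorm (f x)) 0.
      rewrite (_ : (fun _ => _) = cst 0%E); first exact: cvg_cst.
      apply/funext => n; congr EFin; apply/eqP; rewrite eq_le rnorm_ge0 andbT.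
      by have := bound n x; rewrite fx0 mulr0.
    have fx1 : 0 < rnorm (f x) by rewrite lt_def fx0 rnorm_ge0.
    apply: cvg_EFin; first exact: nearW.
    apply/cvgrPdist_lt => e e0.
    have /cvgrPdist_lt/(_ _ e0) h1 := sfx.
    have /cvgrPdist_lt/(_ _ fx1) h2 := sfx.
    have h3 : \forall n \near \oo, `|x| <= n%:R by exact: nbhs_infty_ger.
    near=> n; rewrite /= sub0r normrN ger0_norm ?rnorm_ge0//.
    have h1' : `|0 - rnorm (s n x - f x)| < e by near: n.
    have h2' : `|0 - rnorm (s n x - f x)| < rnorm (f x) by near: n.
    have h3' : `|x| <= n%:R by near: n.
    move: h1' h2'; rewrite sub0r normrN ger0_norm ?rnorm_ge0// => h1' h2'.
    rewrite /t asboolT; first by rewrite rnorm_distC.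
    split=> /=; first by rewrite in_itv /= -ler_norml.
    rewrite -[s n x](subrK (f x)); apply: le_trans (ler_rnormD _ _) _; lra.
  - by apply: aeW => x n _; rewrite /= ger0_norm ?rnorm_ge0// lee_fin bound.
  - by move=> _ _; rewrite integral0.
have fin n : (\int[leb R]_x (rnorm (f x - t n x))%:E < +oo)%E.
  apply: le_lt_trans int3; apply: ge0_le_integral_nonmeas => x _.
    by rewrite lee_fin rnorm_ge0.
  by rewrite lee_fin bound.
have [J tJ] : exists J : X, simple_integral (t n) @[n --> \oo] --> J.
  have /fine_cvgP[_ d0] := cvg0.
  apply: (cauchy_rnorm d0) => n m /=.
  have H k : (\int[leb R]_x (rnorm (f x - t k x))%:E)%E =
    (fine (\int[leb R]_x (rnorm (f x - t k x))%:E)%E)%:E.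
    by rewrite fineK// ge0_fin_numE// ge0_integral_rnorm.
  rewrite -lee_fin EFinD -!H.
  apply: le_trans (rnorm_simple_integralB (it n) (it m)) _.
  rewrite (integral_rnormC _ (t n)).
  by apply: integral_rnorm_triangle => //; exact: strongly_measurable_simple.
by exists J; split=> //; exists t.
Unshelve. all: by end_near. Qed.

End BochnerExistence.

(** * Functions with continuous translation in [L1] *)

Section L1Translation.
Context {R : realType}.
Implicit Types (u v w : R -> R) (A : set R).

Definition L1dist u v : \bar R := (\int[leb R]_x (`|u x - v x|)%:E)%E.

Lemma lmeas_normB u v : lmeas u -> lmeas v -> lmeas (fun x => `|u x - v x|).
Proof. by move=> mu mv; exact/lmeas_norm/lmeasB. Qed.

Lemma L1distC u v : L1dist u v = L1dist v u.
Proof. by apply: eq_integral => x _; rewrite distrC. Qed.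

Lemma L1dist_triangle v u w : lmeas u -> lmeas v -> lmeas w ->
  (L1dist u w <= L1dist u v + L1dist v w)%E.
Proof.
move=> mu mv mw; rewrite /L1dist -(lintegralD (lmeas_normB mu mv) (lmeas_normB mv mw))//.
by apply: lintegral_le => // x; exact: ler_distD.
Qed.

Lemma L1dist_shift u v h : lmeas u -> lmeas v ->
  L1dist (u \o affine 1 h) (v \o affine 1 h) = L1dist u v.
Proof. by move=> mu mv; exact: (lintegral_shift h (lmeas_normB mu mv)). Qed.

Definition L1_continuous u := lmeas u /\
  forall e : R, 0 < e -> exists2 d : R, 0 < d &
    forall h : R, `|h| < d -> (L1dist (u \o affine 1 h) u <= e%:E)%E.

Lemma L1_continuous_closed u : lmeas u ->
  (forall e : R, 0 < e -> exists2 v, L1_continuous v & (L1dist u v <= e%:E)%E) ->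
  L1_continuous u.
Proof.
move=> mu uv; split=> // e e0.
have e3 : 0 < e / 3 by rewrite divr_gt0.
have [v [mv cv] uve] := uv _ e3; have [d d0 vd] := cv _ e3.
exists d => // h /vd hd; have o0 := oner_neq0 R.
have muh := lmeas_affine h o0 mu.
have mvh := lmeas_affine h o0 mv.
apply: le_trans (L1dist_triangle muh mvh mu) _.
rewrite L1dist_shift//; apply: le_trans (leeD uve (L1dist_triangle mvh mv mu)) _.
rewrite (L1distC v u); apply: le_trans (leeD (lexx _) (leeD hd uve)) _.
by rewrite -!EFinD lee_fin; lra.
Qed.

Lemma L1_continuousD u v : L1_continuous u -> L1_continuous v ->
  L1_continuous (fun x => u x + v x).
Proof.
move=> [mu cu] [mv cv]; split; first exact: lmeasD.
move=> e e0; have e2 : 0 < e / 2 by rewrite divr_gt0.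
have [d d0 ud] := cu _ e2; have [d' d'0 vd] := cv _ e2.
exists (Num.min d d'); first by rewrite lt_min d0.
move=> h; rewrite lt_min => /andP[/ud hu /vd hv]; have o0 := oner_neq0 R.
have muh := lmeas_affine h o0 mu.
have mvh := lmeas_affine h o0 mv.
rewrite [e]splitr EFinD; apply: le_trans (leeD hu hv).
rewrite /L1dist -(lintegralD (lmeas_normB muh mu) (lmeas_normB mvh mv))//.
apply: lintegral_le => // x; rewrite /= opprD addrACA; exact: ler_normD.
Qed.

Lemma L1_continuousZ c u : L1_continuous u -> L1_continuous (fun x => c * u x).
Proof.
move=> [mu cu]; split; first exact: (lmeasM (lmeas_cst c) mu).
move=> e e0; have ec : 0 < e / (`|c| + 1) by rewrite divr_gt0// ltr_wpDl.
have [d d0 ud] := cu _ ec; exists d => // h /ud hu.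
have muh := lmeas_affine h (oner_neq0 R) mu.
rewrite /L1dist; under eq_integral do rewrite /= -mulrBr normrM.
rewrite (lintegralZ (normr_ge0 c) (lmeas_normB muh mu))//.
apply: le_trans (lee_pmul _ _ (lexx _) hu) _ => //; first exact: lintegral_ge0.
rewrite -EFinM lee_fin mulrA ler_pdivrMr ?ltr_wpDl//.
by have := normr_ge0 c; nra.
Qed.

Lemma L1_continuous_cst0 : L1_continuous (fun=> 0).
Proof.
split; first exact: lmeas_cst.
move=> e e0; exists 1 => // h _; rewrite /L1dist.
under eq_integral do rewrite /= subrr normr0.
by rewrite integral0 lee_fin ltW.
Qed.

Lemma L1_continuous_sum (I : Type) (r : seq I) (F : I -> R -> R) :
  (forall i, L1_continuous (F i)) -> L1_continuous (fun x => \sum_(i <- r) F i x).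
Proof.
move=> cF; elim: r => [|i r IH].
  by under eq_fun do rewrite big_nil; exact: L1_continuous_cst0.
by under eq_fun do rewrite big_cons; exact: L1_continuousD.
Qed.

(** A translate of an interval differs from it only near the two endpoints. *)
Lemma L1_continuous_itv (a b : R) : a <= b ->
  L1_continuous (\1_(`]a, b]%classic : set R)).
Proof.
move=> ab; split.
  by apply: lmeas_indic; exact: measurable_leb_itv.
move=> e e0; exists (e / 4); first by rewrite divr_gt0.
move=> h he.
pose J (c : R) : set R := `[c - `|h|, c + `|h|]%classic.
have mJ c : measurable (J c : set (lebR R)) by exact: measurable_leb_itv.
have lJ c : (leb R (J c) <= (2 * `|h|)%:E)%E.
  rewrite leb_itv /=; case: ifP => _; last by rewrite lee_fin mulr_ge0.
  by rewrite -EFinB lee_fin; lra.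
apply: (@le_trans _ _ (leb R (J a) + leb R (J b))%E); last first.
  apply: le_trans (leeD (lJ a) (lJ b)) _; rewrite -EFinD lee_fin; lra.
rewrite -(lintegral_indic (mJ a)) -(lintegral_indic (mJ b)).
rewrite -(lintegralD (lmeas_indic (mJ a)) (lmeas_indic (mJ b)))//.
apply: lintegral_le => // x.
have [xa|xa] := boolP (x \in J a).
  rewrite [\1_(J a) x]indicE xa /=.
  apply: (@le_trans _ _ 1); last by rewrite lerDl.
  by rewrite !indicE; do 2 case: (_ \in _);
    rewrite ?subrr ?subr0 ?sub0r ?normrN ?normr1 ?normr0.
have [xb|xb] := boolP (x \in J b).
  rewrite [\1_(J b) x]indicE xb /=.
  apply: (@le_trans _ _ 1); last by rewrite lerDr.
  by rewrite !indicE; do 2 case: (_ \in _);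
    rewrite ?subrr ?subr0 ?sub0r ?normrN ?normr1 ?normr0.
rewrite [leLHS](_ : _ = 0); first by rewrite addr_ge0.
apply/eqP; rewrite normr_eq0 subr_eq0 /= !indicE; apply/eqP; congr (nat_of_bool _)%:R.
move: xa xb; rewrite !notin_setE /J /= !in_itv /= /affine mul1r => xa xb.
have := ler_norm h; have := ler_norm (- h); rewrite normrN => h1 h2.
apply/idP/idP; rewrite !inE /= !in_itv /= => /andP[c1 c2]; apply/andP; split.
- rewrite ltNge; apply/negP => c3; apply: xa; apply/andP; split; lra.
- rewrite leNgt; apply/negP => c3; apply: xb; apply/andP; split; lra.
- rewrite ltNge; apply/negP => c3; apply: xa; apply/andP; split; lra.
- rewrite leNgt; apply/negP => c3; apply: xb; apply/andP; split; lra.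
Qed.

End L1Translation.

(** * Translation is continuous in [L1] *)

Section L1Density.
Context {R : realType}.
Implicit Types (u v w : R -> R) (A : set R).

Lemma leb_itv_cover A (e : R) : 0 < e -> (leb R A < +oo)%E ->
  exists I : nat -> R * R,
    [/\ forall k, (I k).1 <= (I k).2,
        A `<=` \bigcup_k `](I k).1, (I k).2]%classic &
        (\sum_(k <oo) leb R `](I k).1, (I k).2]%classic < leb R A + e%:E)%E].
Proof.
move=> e0 Aoo; have Afin : leb R A \is a fin_num by rewrite ge0_fin_numE.
have [_ [J [mJ AJ] <-] SJ] := lb_ereal_inf_adherent e0 Afin.
have JE k : {xy : R * R | xy.1 <= xy.2 /\ J k = `]xy.1, xy.2]%classic}.
  apply: cid; have /ocitvP[->|[xy /ltW xy12 ->]] : ocitv (J k) by exact: mJ.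
    by exists (0, 0); rewrite set_itvoc0.
  by exists xy.
exists (fun k => sval (JE k)); split.
- by move=> k; case: (svalP (JE k)).
- by move=> x /AJ[k _ Jkx]; exists k => //; case: (svalP (JE k)) => _ <-.
- rewrite (eq_eseriesr (g := fun k => wlength idfun (J k))) // => k _.
  by case: (svalP (JE k)) => _ <-; exact: measurable_mu_extE.
Qed.

Let cover_arith (D m s n : \bar R) (e : R) :
  (0 <= D -> 0 <= n -> n < +oo -> m \is a fin_num -> s \is a fin_num ->
   D + m + n <= s + s -> s - e%:E <= n -> s < m + e%:E -> D <= (2 * e)%:E)%E.
Proof.
case: D => [D| |]; case: n => [n| |] //; case: m => [m| |] //; case: s => [s| |] //.
rewrite -EFinB -!EFinD !lee_fin !lte_fin => _ _ _ _ _ h1 h2 h3; lra.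
Qed.

(** Cover [A] by intervals [B k] of total length at most [leb R A + e]. With
    [u] the indicator of [A], [v] the sum of the first [N] indicators of the
    [B k] and [V] the whole series, [u <= V] and [v <= V] give
    [|u - v| + u + v = 2 max(u, v) <= 2 V]; integrating, [|u - v|] has a small
    integral once the first [N] lengths nearly exhaust the total. Stated with
    sums instead of differences, every term is nonnegative and no
    integrability has to be checked. *)
Lemma L1_continuous_indic A : measurable (A : set (lebR R)) ->
  (leb R A < +oo)%E -> L1_continuous (\1_A : R -> R).
Proof.
move=> mA Aoo; apply: L1_continuous_closed; first exact: lmeas_indic.
move=> e e0; have e2 : 0 < e / 2 by rewrite divr_gt0.
have [I [I12 AI SI]] := leb_itv_cover e2 Aoo.
pose B k : set R := `](I k).1, (I k).2]%classic.
have mB k : measurable (B k : set (lebR R)) by exact: measurable_leb_itv.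
pose v N x : R := \sum_(k <- iota 0 N) \1_(B k) x.
have cv N : L1_continuous (v N).
  by apply: L1_continuous_sum => k; exact: L1_continuous_itv.
have mv N : lmeas (v N) by case: (cv N).
have v0 N x : 0 <= v N x by apply: sumr_ge0.
pose S : \bar R := (\sum_(k <oo) leb R (B k))%E.
have Av : (leb R A <= S)%E.
  by apply: le_trans (leb_mono AI) _; exact: leb_sigma_subadditive.
have Afin : leb R A \is a fin_num by rewrite ge0_fin_numE.
have Sfin : S \is a fin_num.
  rewrite ge0_fin_numE ?(le_trans _ Av)//; apply: lt_trans SI _.
  by rewrite lte_add_pinfty// ltry.
have Iv N : (\int[leb R]_x (v N x)%:E = \sum_(0 <= k < N) leb R (B k))%E.
  rewrite /index_iota subn0 /v; elim: (iota 0 N) => [|k r IH].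
    by under eq_integral do rewrite big_nil; rewrite integral0 big_nil.
  have mr : lmeas (fun x => \sum_(j <- r) (\1_(B j) x : R)).
    by apply: (L1_continuous_sum r _).1 => j; exact: L1_continuous_itv.
  have r0 x : 0 <= \sum_(j <- r) (\1_(B j) x : R) by apply: sumr_ge0.
  under eq_integral do rewrite big_cons.
  by rewrite (lintegralD (lmeas_indic (mB k)) mr)// IH big_cons lintegral_indic.
have [N SN] : exists N, (S - (e / 2)%:E <= \sum_(0 <= k < N) leb R (B k))%E.
  apply: contrapT => /forallNP hN.
  have : (S <= S - (e / 2)%:E)%E.
    apply: lime_le; first exact: is_cvg_nneseries.
    by apply: nearW => N; rewrite leNgt; apply/negP => /ltW; exact: hN.
  have Se : (S - (e / 2)%:E < S)%E by rewrite lteBlDr// lteDl// lte_fin.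
  by move=> /le_lt_trans/(_ Se); rewrite ltxx.
exists (v N) => //.
have key : (L1dist \1_A (v N) + leb R A + \sum_(0 <= k < N) leb R (B k) <= S + S)%E.
  have mAv := lmeas_normB (lmeas_indic mA) (mv N).
  rewrite -(lintegral_indic mA) -Iv /L1dist.
  rewrite -(lintegralD mAv (lmeas_indic mA))//.
  rewrite -(lintegralD (lmeasD mAv (lmeas_indic mA)) (mv N))//.
  have mB1 k : lmeas (fun x => (\1_(B k) x : R)%:E) by exact/lmeas_EFin/lmeas_indic.
  have B10 k x : (0 <= (\1_(B k) x : R)%:E)%E by rewrite lee_fin.
  have -> : S = (\int[leb R]_x \sum_(k <oo) (\1_(B k) x : R)%:E)%E.
    rewrite (lintegral_series mB1 B10).
    by apply: eq_eseriesr => k _; rewrite lintegral_indic.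
  have sB0 x : (0 <= \sum_(k <oo) (\1_(B k) x : R)%:E)%E by exact: nneseries_ge0.
  have msB := lmeas_series mB1 B10.
  rewrite -(elintegralD measurableT msB msB (fun x _ => sB0 x) (fun x _ => sB0 x)).
  apply: ge0_le_integral_nonmeas => x _; first by rewrite lee_fin !addr_ge0.
  set V := (\sum_(k <oo) _)%E.
  have vV : ((v N x)%:E <= V)%E.
    have -> : (v N x)%:E = (\sum_(0 <= k < N) (\1_(B k) x : R)%:E)%E.
      by rewrite /v -sumEFin /index_iota subn0.
    exact: nneseries_lim_ge.
  have AV : ((\1_A x : R)%:E <= V)%E.
    have [Ax|Ax] := pselect (A x); last first.
      by rewrite indicE memNset//; apply: nneseries_ge0 => k _ _; rewrite lee_fin.
    have [k _ Bkx] := AI _ Ax.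
    rewrite indicE mem_set//; apply: (@le_trans _ _ (\sum_(0 <= j < k.+1) (\1_(B j) x : R)%:E)%E).
      rewrite big_nat_recr//= indicE mem_set// leeDr//.
      by apply: sume_ge0 => j _; rewrite lee_fin.
    exact: nneseries_lim_ge.
  have [vA|Av'] := leP (\1_A x : R) (v N x).
    rewrite ler0_norm ?subr_le0// opprB subrK EFinD; exact: leeD.
  rewrite gtr0_norm ?subr_gt0//.
  rewrite (_ : _ + _ + _ = \1_A x + \1_A x); first by rewrite EFinD leeD.
  by rewrite addrAC subrK.
have D0 : (0 <= L1dist \1_A (v N))%E by exact: lintegral_ge0.
have Nfin : (\sum_(0 <= k < N) leb R (B k) < +oo)%E.
  apply: le_lt_trans (_ : S < +oo)%E; last by rewrite -ge0_fin_numE ?(le_trans _ Av).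
  exact: nneseries_lim_ge.
have N0 : (0 <= \sum_(0 <= k < N) leb R (B k))%E by apply: sume_ge0.
have -> : e = 2 * (e / 2) by field.
exact: (cover_arith D0 N0 Nfin Afin Sfin key SN SI).
Qed.

(** Simple functions are dense in [L1], and a nonzero value of an integrable
    simple function is taken on a set of finite measure. *)
Lemma L1_continuous_integrable u : lmeas u ->
  (\int[leb R]_x (`|u x|)%:E < +oo)%E -> L1_continuous u.
Proof.
move=> mu uoo; apply: L1_continuous_closed => // e e0.
have iu : (leb R).-integrable setT (EFin \o (u : lebR R -> R)).
  by apply/integrableP; split; [exact: lmeas_EFin|exact: uoo].
have [g [ig _ /fine_cvgP[gfin gu]]] := approximation_sfun_integrable measurableT iu.
have /cvgrPdist_lt/(_ _ e0) hg := gu.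
near \oo => n.
exists (g n : lebR R -> R); last first.
  have fn : (\int[leb R]_x `|(EFin \o u) x - (g n x)%:E|)%E \is a fin_num by near: n.
  have : `|0 - fine (\int[leb R]_x `|(EFin \o u) x - (g n x)%:E|)%E| < e by near: n.
  rewrite sub0r normrN ger0_norm ?fine_ge0 ?integral_ge0// => he.
  by rewrite -lte_fin fineK// in he; exact: ltW.
have -> : (g n : lebR R -> R) =
    (fun x => \sum_(r <- finmap.enum_fset (fset_set (range (g n)))) r * \1_(g n @^-1` [set r]) x).
  by apply/funext => x; rewrite fimfunE fsbig_finite.
apply: L1_continuous_sum => r.
have [->|r0] := eqVneq r 0.
  by under eq_fun do rewrite mul0r; exact: L1_continuous_cst0.
apply: L1_continuousZ; apply: L1_continuous_indic; first exact: measurable_sfunP.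
have /integrableP[_ goo] := ig n.
have mr : measurable (g n @^-1` [set r] : set (lebR R)) by exact: measurable_sfunP.
have r1 : 0 < `|r| by rewrite normr_gt0.
suff H : (`|r|%:E * leb R (g n @^-1` [set r]) < +oo)%E.
  rewrite ltey; apply/eqP => lr; move: H.
  by rewrite lr gt0_muley ?lte_fin.
rewrite -(lintegral_indic mr) -(lintegralZ (normr_ge0 r) (lmeas_indic mr))//.
apply: le_lt_trans goo; apply: ge0_le_integral_nonmeas => x _.
  by rewrite lee_fin mulr_ge0.
rewrite /= lee_fin indicE; case: (boolP (x \in _)) => [|_].
  by rewrite inE /= => ->; rewrite mulr1.
by rewrite mulr0.
Unshelve. all: by end_near. Qed.

End L1Density.

(** * The convolution of an integrable and a bounded function *)

Section Convolution.
Context {R : realType} {X : completeNormedModType R[i]}.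
Variables (psi : R -> R[i]) (f : R -> X).
Hypotheses (hpsi : in_L1 psi) (hf : in_Linfty f).

Lemma lmeas_cabs (g : R -> R[i]) :
  lmeas (fun x => complex.Re (g x)) -> lmeas (fun x => complex.Im (g x)) ->
  lmeas (fun x => cabs (g x)).
Proof.
move=> mr mi; under eq_fun do rewrite cabsE.
have ms : measurable_fun [set: R] (@Num.sqrt R).
  by apply: continuous_measurable_fun; exact: sqrt_continuous.
apply: (measurableT_comp ms).
exact: (lmeasD (lmeasM mr mr) (lmeasM mi mi)).
Qed.

Let mRe : lmeas (fun x => complex.Re (psi x)). Proof. by case: hpsi. Qed.
Let mIm : lmeas (fun x => complex.Im (psi x)). Proof. by case: hpsi. Qed.
Let mC : lmeas (fun x => cabs (psi x)). Proof. exact: lmeas_cabs. Qed.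

Lemma in_Linfty_ae_bound : exists2 M : R, 0 <= M &
  {ae leb R, forall x, rnorm (f x) <= M}.
Proof.
have [_ foo] := hf.
have := ess_sup_ge (leb R) (fun x => (rnorm (f x))%:E).
case: (ess_sup _ _) foo => [M| |] // _ fM.
- exists (Num.max M 0); first by rewrite le_max lexx orbT.
  by apply: ae_leb_imp fM => x; rewrite lee_fin le_max => ->.
- by exists 0 => //; apply: ae_leb_imp fM => x; rewrite leNgt ltNyr.
Qed.

Lemma sub_affine (T : Type) (g : R -> T) x :
  (fun y => g (x - y)) = g \o affine (-1) x.
Proof. by apply/funext => y; rewrite /affine /= mulN1r addrC. Qed.

Let m1 : -1 != 0 :> R. Proof. by rewrite oppr_eq0 oner_neq0. Qed.

Lemma lintegral_reflect (u : R -> R) x : lmeas u -> (forall z, 0 <= u z) ->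
  (\int[leb R]_y (u (x - y))%:E = \int[leb R]_y (u y)%:E)%E.
Proof.
move=> mu u0; have := @ge0_integral_affine R (-1) x setT (fun x => (u x)%:E)
  m1 measurableT (lmeas_EFin mu) (fun x _ => u0 x : (0 <= (u x)%:E)%E).
rewrite preimage_setT normrN normr1 invr1 mul1e => <-.
by apply: eq_integral => y _; rewrite /affine mulN1r addrC.
Qed.

Lemma strongly_measurable_convolutant x :
  strongly_measurable (fun y => psi (x - y) *: f y).
Proof.
have [mf _] := hf.
apply: (strongly_measurableZ _ _ mf).
- rewrite (sub_affine (fun z => complex.Re (psi z))); exact: (lmeas_affine x m1 mRe).
- rewrite (sub_affine (fun z => complex.Im (psi z))); exact: (lmeas_affine x m1 mIm).
Qed.

Lemma integral_mul_rnorm_le (u : R -> R) (g : R -> X) M : lmeas u ->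
  (forall x, 0 <= u x) -> 0 <= M -> strongly_measurable g ->
  {ae leb R, forall x, rnorm (g x) <= M} ->
  (\int[leb R]_x (u x * rnorm (g x))%:E <= M%:E * \int[leb R]_x (u x)%:E)%E.
Proof.
move=> mu u0 M0 mg gM; rewrite -(lintegralZ M0 mu u0).
have mug := lmeasM mu (measurable_rnorm mg).
have mMu := lmeasM (lmeas_cst M) mu.
apply: (@ae_ge0_le_integral _ (lebR R) R (leb R) setT measurableT
  (fun x => (u x * rnorm (g x))%:E) (fun x => (M * u x)%:E) _ (lmeas_EFin mug) _
  (lmeas_EFin mMu)).
- by move=> x _; rewrite lee_fin mulr_ge0// rnorm_ge0.
- by move=> x _; rewrite lee_fin mulr_ge0.
- by apply: ae_leb_imp gM => x gx _; rewrite lee_fin mulrC ler_wpM2r.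
Qed.

Lemma integral_cabs_fin : (\int[leb R]_x (cabs (psi x))%:E)%E \is a fin_num.
Proof.
rewrite ge0_fin_numE; first by case: hpsi.
by apply: lintegral_ge0 => x; exact: cabs_ge0.
Qed.

Lemma bochner_integrable_convolutant x :
  bochner_integrable (fun y => psi (x - y) *: f y).
Proof.
have [M M0 fM] := in_Linfty_ae_bound.
apply: bochner_integrable_norm; first exact: strongly_measurable_convolutant.
under eq_integral do rewrite rnormZ.
have mx : lmeas (fun y => cabs (psi (x - y))).
  rewrite (sub_affine (fun z => cabs (psi z))); exact: (lmeas_affine x m1 mC).
apply: le_lt_trans (integral_mul_rnorm_le mx _ M0 hf.1 fM) _.
  by move=> y; exact: cabs_ge0.
rewrite (lintegral_reflect x mC); last by move=> z; exact: cabs_ge0.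
by rewrite ltey_eq fin_numM// integral_cabs_fin.
Qed.

Lemma convolutionP x :
  is_bochner_integral (fun y => psi (x - y) *: f y) (convolution psi f x).
Proof. exact: bochner_integralP (bochner_integrable_convolutant x). Qed.

Lemma convolution_bounded : exists2 K : R, 0 <= K &
  forall x, rnorm (convolution psi f x) <= K.
Proof.
have [M M0 fM] := in_Linfty_ae_bound.
exists (fine (M%:E * \int[leb R]_x (cabs (psi x))%:E)%E).
  apply: fine_ge0; apply: mule_ge0 => //.
  by apply: lintegral_ge0 => x; exact: cabs_ge0.
move=> x; rewrite -lee_fin fineK; last by rewrite fin_numM// integral_cabs_fin.
apply: le_trans (rnorm_bochner_integral (convolutionP x)) _.
under eq_integral do rewrite rnormZ.
have mx : lmeas (fun y => cabs (psi (x - y))).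
  rewrite (sub_affine (fun z => cabs (psi z))); exact: (lmeas_affine x m1 mC).
apply: le_trans (integral_mul_rnorm_le mx _ M0 hf.1 fM) _.
  by move=> y; exact: cabs_ge0.
rewrite (lintegral_reflect x mC)//; by move=> z; exact: cabs_ge0.
Qed.

(** The bound of [f] comes out of the integral, and the substitution
    [z = x - y] leaves the [L1] distance of [psi] to its translate by [x' - x]. *)
Lemma convolution_continuous (x e : R) : 0 < e -> exists2 d : R, 0 < d &
  forall x' : R, `|x' - x| < d ->
    rnorm (convolution psi f x' - convolution psi f x) < e.
Proof.
move=> e0; have [M M0 fM] := in_Linfty_ae_bound.
have L1of (u : R -> R) : lmeas u -> (forall z, `|u z| <= cabs (psi z)) -> L1_continuous u.
  move=> mu uC; apply: L1_continuous_integrable => //.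
  case: hpsi => _ _; apply: le_lt_trans; exact: lintegral_le.
have [_ cRe] := L1of _ mRe (fun z => Re_le_cabs (psi z)).
have [_ cIm] := L1of _ mIm (fun z => Im_le_cabs (psi z)).
pose e' := e / (3 * (M + 1)).
have e'0 : 0 < e' by rewrite divr_gt0// mulr_gt0// ltr_wpDl.
have [d d0 dRe] := cRe _ e'0; have [d' d'0 dIm] := cIm _ e'0.
exists (Num.min d d'); first by rewrite lt_min d0.
move=> x'; rewrite lt_min => /andP[/dRe hRe /dIm hIm].
rewrite -lte_fin.
apply: le_lt_trans (rnorm_bochner_integralB (convolutionP x') (convolutionP x)) _.
under eq_integral do rewrite -scalerBl rnormZ.
pose D z := psi (z + (x' - x)) - psi z.
have DE y : psi (x' - y) - psi (x - y) = D (x - y).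
  by rewrite /D; congr (psi _ - _); ring.
under eq_integral do rewrite DE.
have shiftE (u : R -> R) : (fun z => u (z + (x' - x))) = u \o affine 1 (x' - x).
  by apply/funext => z; rewrite /affine /= mul1r.
have mDRe : lmeas (fun z => complex.Re (D z)).
  rewrite /D; under eq_fun do rewrite raddfB.
  apply: lmeasB mRe; rewrite (shiftE (fun z => complex.Re (psi z))).
  exact: (lmeas_affine _ (oner_neq0 R) mRe).
have mDIm : lmeas (fun z => complex.Im (D z)).
  rewrite /D; under eq_fun do rewrite raddfB.
  apply: lmeasB mIm; rewrite (shiftE (fun z => complex.Im (psi z))).
  exact: (lmeas_affine _ (oner_neq0 R) mIm).
have mD := lmeas_cabs mDRe mDIm.
have mDx : lmeas (fun y => cabs (D (x - y))).
  rewrite (sub_affine (fun z => cabs (D z))); exact: (lmeas_affine x m1 mD).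
apply: le_lt_trans (integral_mul_rnorm_le mDx _ M0 hf.1 fM) _.
  by move=> y; exact: cabs_ge0.
rewrite (lintegral_reflect x mD); last by move=> z; exact: cabs_ge0.
have : (\int[leb R]_z (cabs (D z))%:E <= e'%:E + e'%:E)%E.
  apply: le_trans (leeD hRe hIm).
  have nRe := lmeas_normB (lmeas_affine (x' - x) (oner_neq0 R) mRe) mRe.
  have nIm := lmeas_normB (lmeas_affine (x' - x) (oner_neq0 R) mIm) mIm.
  rewrite /L1dist -(lintegralD nRe nIm (fun z => normr_ge0 _) (fun z => normr_ge0 _)).
  apply: lintegral_le => z; first exact: cabs_ge0.
  apply: le_trans (cabs_le_ReIm _) _.
  by rewrite /D !raddfB /= /affine !mul1r.
move=> /(lee_wpmul2l (_ : 0 <= M%:E)%E); rewrite lee_fin => /(_ M0) /le_lt_trans; apply.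
rewrite -EFinD -EFinM lte_fin /e'.
rewrite (_ : M * _ = e * ((2 * M) / (3 * (M + 1)))); last first.
  by field; rewrite gt_eqF// ltr_wpDl.
rewrite gtr_pMr// ltr_pdivrMr ?mul1r; last by rewrite mulr_gt0// ltr_wpDl.
lra.
Qed.

Lemma strongly_measurable_convolution : strongly_measurable (convolution psi f).
Proof.
apply: strongly_measurable_continuous => x e /(convolution_continuous x).
exact.
Qed.

Lemma in_Linfty_convolution : in_Linfty (convolution psi f).
Proof.
split; first exact: strongly_measurable_convolution.
have [K K0 cK] := convolution_bounded.
apply: (@le_lt_trans _ _ K%:E); last exact: ltry.
by apply/ess_supP; apply: aeW => x; rewrite lee_fin.
Qed.

(** Translating the integration variable moves [tau] from [psi] to [f]. *)
Lemma convolution_increment_le (x tau : R) :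
  ((rnorm (convolution psi f (x + tau) - convolution psi f x))%:E <=
   \int[leb R]_y (cabs (psi (x - y)) * rnorm (f (y + tau) - f y))%:E)%E.
Proof.
have := is_bochner_integral_shift tau (convolutionP (x + tau)).
move=> /rnorm_bochner_integralB/(_ (convolutionP x)).
rewrite (_ : (\int[leb R]_y _)%E =
  (\int[leb R]_y (cabs (psi (x - y)) * rnorm (f (y + tau) - f y))%:E)%E) //.
apply: eq_integral => y _; rewrite /affine /= mul1r -rnormZ scalerBr.
by congr (rnorm (psi _ *: _ - _))%:E; ring.
Qed.

End Convolution.

(** * Variable exponent norms *)

Section VariableExponentTheory.
Context {R : realType}.
Implicit Types (p q : R -> \bar R) (u v : R -> R) (r s t : \bar R).

Notation I01 := (`[0%R, 1%R]%classic : set (lebR R)).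

Lemma vphi_ge0 r t : (0 <= vphi r t)%E.
Proof. by case: r => [r| |] /=; [exact: poweR_ge0| |]; case: ifP. Qed.

Lemma le_vphi r s t : (1 <= r -> 0 <= s -> s <= t -> vphi r s <= vphi r t)%E.
Proof.
case: r => [r| |] //= r1 s0 st.
  rewrite lee_fin in r1; apply: gt0_ler_poweR => //.
  - exact: le_trans ler01 r1.
  - by rewrite in_itv /= s0 leey.
  - by rewrite in_itv /= (le_trans s0 st) leey.
by case: (leP t 1%E) => [t1|_]; [rewrite (le_trans st t1)|exact: leey].
Qed.

Lemma vphi_le1 r t : (1 <= r -> 0 <= t -> t <= 1 -> vphi r t <= 1)%E.
Proof.
move=> r1 t0 t1; apply: le_trans (le_vphi r1 t0 t1) _.
by case: r r1 => [r| |] // _; rewrite /vphi ?poweR1r ?lexx.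
Qed.

(** Young's inequality, weakened by dropping the factors [1/p] and [1/q], which
    are at most 1. In this form it also holds for the exponents [1] and [+oo]. *)
Lemma vphi_young (p q : \bar R) (a b : R) : (1 <= p -> 1 <= q ->
  p^-1 + q^-1 = 1 -> 0 <= a%:E -> 0 <= b%:E ->
  (a * b)%:E <= vphi p a%:E + vphi q b%:E)%E.
Proof.
move=> p1 q1 pq a0 b0; rewrite !lee_fin in a0 b0.
case: p p1 pq => [p| |] // p1; case: q q1 => [q| |] // q1.
- have p0 : 0 < p := lt_le_trans ltr01 p1; have q0 : 0 < q := lt_le_trans ltr01 q1.
  rewrite !inver !gt_eqF// -EFinD => -[pq].
  rewrite /vphi !poweR_EFin -EFinD lee_fin.
  apply: le_trans (conjugate_powR a0 b0 p0 q0 pq) _.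
  by apply: lerD; rewrite ler_pdivrMr// ler_peMr// powR_ge0.
- rewrite invey adde0 => /eqP; rewrite inve_eq1 eqe => /eqP ->.
  rewrite /vphi poweRe1 ?lee_fin//; case: ifPn => [b1|_]; last by rewrite addey// leey.
  by rewrite adde0 lee_fin ler_piMr.
- rewrite invey add0e => /eqP; rewrite inve_eq1 eqe => /eqP ->.
  rewrite /vphi poweRe1 ?lee_fin//; case: ifPn => [a1|_]; last by rewrite addye// leey.
  by rewrite add0e lee_fin ler_piMl.
- by rewrite invey adde0 => /eqP; rewrite eqe eq_sym oner_eq0.
Qed.

Lemma measurable_vphi p u : exponent p -> measurable_fun I01 u ->
  (forall x, 0 <= u x) -> measurable_fun I01 (fun x => vphi (p x) (u x)%:E).
Proof.
move=> [mp p1] mu u0; have mD : measurable I01 by exact: measurable_leb_itv.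
pose w (x : lebR R) : \bar R := if (p x == +oo)%E then
    (if (u x <= 1)%R then 0 else +oo)%E
  else (if u x == 0 then 0%R else expR (fine (p x) * ln (u x)))%:E.
apply: (eq_measurable_fun w).
  move=> x; rewrite inE /= in_itv /= => /p1; rewrite /w.
  case: (p x) => [r| |] //= r1.
  rewrite /powR; case: ifP => // _; congr EFin.
  by rewrite gt_eqF// (lt_le_trans ltr01).
have mif d (T : measurableType d) (c : lebR R -> bool) (g h : lebR R -> T) :
    measurable_fun I01 c -> measurable_fun I01 g -> measurable_fun I01 h ->
    measurable_fun I01 (fun x => if c x then g x else h x).
  move=> mc mg mh; apply: measurable_fun_if; [exact: mD|exact: mc| |].
  - exact: (measurable_funS mD (@subIsetl _ _ _) mg).
  - exact: (measurable_funS mD (@subIsetl _ _ _) mh).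
apply: (mif _ _).
- exact: (measurable_fun_eqe mp (measurable_cst _)).
- apply: (mif _ _); [|exact: measurable_cst|exact: measurable_cst].
  exact: (measurable_fun_ler mu (measurable_cst _)).
- apply: (measurableT_comp (@EFin_measurable R setT)).
  apply: (mif _ _); [|exact: measurable_cst|].
    exact: (measurable_fun_eqr mu (measurable_cst _)).
  apply: (measurableT_comp (@measurable_expR R)); apply: measurable_funM.
    exact: (measurableT_comp (@fine_measurable R setT measurableT) mp).
  exact: (measurableT_comp (@measurable_ln R) mu).
Qed.

(** The constant 2 is the sum of the two modulars in the pointwise Young
    inequality for the normalised functions. *)
Lemma modular_hoelder p q u v (a b : R) : exponent p -> exponent q ->
  (forall x : R, 0 <= x <= 1 -> ((p x)^-1 + (q x)^-1 = 1)%E) ->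
  measurable_fun I01 u -> measurable_fun I01 v -> 0 < a -> 0 < b ->
  (modular p (fun x => (`|u x| / a)%:E) <= 1)%E ->
  (modular q (fun x => (`|v x| / b)%:E) <= 1)%E ->
  (\int[leb R]_(x in I01) (`|u x| * `|v x|)%:E <= (2 * (a * b))%:E)%E.
Proof.
move=> hp hq hpq mu mv a0 b0 ua vb.
have mD : measurable I01 by exact: measurable_leb_itv.
have mua : measurable_fun I01 (fun x => `|u x| / a).
  apply: measurable_funM (measurable_cst _).
  exact: (measurableT_comp (@normr_measurable R setT) mu).
have mvb : measurable_fun I01 (fun x => `|v x| / b).
  apply: measurable_funM (measurable_cst _).
  exact: (measurableT_comp (@normr_measurable R setT) mv).
have ua0 x : 0 <= `|u x| / a by rewrite divr_ge0// ltW.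
have vb0 x : 0 <= `|v x| / b by rewrite divr_ge0// ltW.
have young : (\int[leb R]_(x in I01) ((`|u x| / a) * (`|v x| / b))%:E <= 2%:E)%E.
  apply: (@le_trans _ _ (modular p (fun x => (`|u x| / a)%:E) +
      modular q (fun x => (`|v x| / b)%:E))%E); last first.
    by apply: le_trans (leeD ua vb) _; rewrite -EFinD lee_fin; lra.
  rewrite /modular -(elintegralD mD (measurable_vphi hp mua ua0)
    (measurable_vphi hq mvb vb0) (fun x _ => vphi_ge0 _ _) (fun x _ => vphi_ge0 _ _)).
  apply: ge0_le_integral_nonmeas => x Dx; first by rewrite lee_fin mulr_ge0.
  have x01 : 0 <= x <= 1 by move: Dx; rewrite /= in_itv.
  apply: vphi_young; [exact: hp.2|exact: hq.2|exact: hpq|by rewrite lee_fin..].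
have ab0 : 0 <= a * b by rewrite mulr_ge0// ltW.
have -> : (\int[leb R]_(x in I01) (`|u x| * `|v x|)%:E =
  \int[leb R]_(x in I01) ((a * b)%:E * ((`|u x| / a) * (`|v x| / b))%:E))%E.
  by apply: eq_integral => x _; rewrite -EFinM; congr EFin; field; rewrite !gt_eqF.
rewrite (elintegralZ mD _ _ ab0).
- rewrite (mulrC 2) EFinM. exact: (lee_wpmul2l (ab0 : (0 <= (a * b)%:E)%E) young).
- apply: (measurableT_comp (@EFin_measurable R setT)); exact: measurable_funM.
- by move=> x _; rewrite lee_fin mulr_ge0.
Qed.

(** Since [e] is positive the right-hand side is [+oo] when the norm of [v] is,
    in particular when [v] is not measurable. *)
Lemma Lp_norm_hoelder p q u v (e : R) : exponent p -> exponent q ->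
  (forall x : R, 0 <= x <= 1 -> ((p x)^-1 + (q x)^-1 = 1)%E) -> 0 < e ->
  (Lp_norm p u <= e%:E)%E ->
  (\int[leb R]_(x in I01) (`|u x| * `|v x|)%:E <= (2 * e)%:E * Lp_norm q v)%E.
Proof.
move=> hp hq hpq e0 ue; set I := (X in (X <= _)%E).
have e20 : 0 < 2 * e by rewrite mulr_gt0.
rewrite -lee_pdivrMl//; apply: le_ereal_inf_tmp => _ [b [mv b0 vb] <-].
rewrite lee_pdivrMl// -EFinM (_ : 2 * e * b = 2 * b * e); last by ring.
have b20 : 0 < 2 * b by rewrite mulr_gt0.
rewrite EFinM -lee_pdivrMl//; apply: le_trans ue.
apply: le_ereal_inf_tmp => _ [a [mu a0 ua] <-].
rewrite lee_pdivrMl// -EFinM (_ : 2 * b * a = 2 * (a * b)); last by ring.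
exact: (modular_hoelder hp hq hpq mu mv a0 b0 ua vb).
Qed.

Lemma Lp_norm_ge0 p u : (0 <= Lp_norm p u)%E.
Proof. by apply: le_ereal_inf_tmp => _ [a [_ a0 _] <-]; rewrite lee_fin ltW. Qed.

Lemma le_modular p (s t : R -> \bar R) : exponent p ->
  (forall x : R, 0 <= x <= 1 -> (0 <= s x)%E) ->
  (forall x : R, 0 <= x <= 1 -> (s x <= t x)%E) ->
  (modular p s <= modular p t)%E.
Proof.
move=> [_ p1] s0 st; apply: ge0_le_integral_nonmeas => x /=.
  by move=> _; exact: vphi_ge0.
rewrite in_itv /= => x01; apply: le_vphi; [exact: p1|exact: s0|exact: st].
Qed.

Lemma leb_I01 : leb R I01 = 1%E.
Proof. by rewrite (leb_itv `[0, 1]) /= lte_fin ltr01 -EFinB subr0. Qed.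

Lemma in_Lp_bounded p u K : exponent p -> measurable_fun I01 u ->
  (forall x, `|u x| <= K) -> in_Lp p u.
Proof.
move=> hp mu uK; split=> //; have K0 : 0 <= K := le_trans (normr_ge0 _) (uK 0).
have K1 : 0 < K + 1 by rewrite ltr_wpDl.
exists (K + 1)^-1; first by rewrite invr_gt0.
apply: (@le_lt_trans _ _ 1%E); last exact: ltry.
rewrite -leb_I01 -[leb R _]mul1e.
have mD : measurable I01 by exact: measurable_leb_itv.
rewrite -(integral_cst (leb R) mD 1%E); apply: ge0_le_integral_nonmeas => x /=.
  by move=> _; exact: vphi_ge0.
rewrite in_itv /= => x01; apply: vphi_le1.
- exact: hp.2.
- by rewrite lee_fin mulr_ge0// invr_ge0 ltW.
- by rewrite lee_fin ler_pdivrMl// mulr1 (le_trans (uK _))// lerDl.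
Qed.

End VariableExponentTheory.

(** * Jensen's inequality *)

Section Jensen.
Context {R : realType}.
Variable phi : R -> R.
Hypotheses (phi_convex : convex_function [set x : R^o | 0 <= x] phi)
  (phi_mono : forall x y : R, 0 <= x -> x <= y -> phi x <= phi y).

Lemma convex_chord (x c y : R) : 0 <= x -> x <= c -> c <= y -> x < y ->
  (y - x) * phi c <= (y - c) * phi x + (c - x) * phi y.
Proof.
move=> x0 xc cy xy; have yx : 0 < y - x by rewrite subr_gt0.
pose t := (y - c) / (y - x).
have t0 : 0 <= t by rewrite divr_ge0 ?subr_ge0// ltW.
have t1 : t <= 1 by rewrite ler_pdivrMr// mul1r lerB.
have y0 : 0 <= y := le_trans x0 (ltW xy).
have : phi (t * x + (1 - t) * y) <= t * phi x + (1 - t) * phi y :=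
  phi_convex (Itv01 t0 t1) (mem_set (x0 : [set x : R^o | 0 <= x] x))
    (mem_set (y0 : [set x : R^o | 0 <= x] y)).
rewrite (_ : t * x + (1 - t) * y = c); last first.
  by rewrite /t; field; rewrite gt_eqF.
move=> /(ler_wpM2l (ltW yx)) H; rewrite (le_trans H)// le_eqVlt; apply/orP; left.
by apply/eqP; rewrite /t; field; rewrite gt_eqF.
Qed.

(** For [c > 0] the slope [m] is the left derivative at [c], the supremum of the
    slopes of the chords ending at [c]. At [c = 0] monotonicity alone gives the
    slope 0, although [phi] has no left neighbourhood there. *)
Lemma supporting_line (c : R) : 0 <= c ->
  exists2 m : R, 0 <= m & forall y, 0 <= y -> phi c + m * y <= phi y + m * c.
Proof.
rewrite le_eqVlt => /predU1P[<-|c0].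
  by exists 0 => // y y0; rewrite !mul0r !addr0; exact: phi_mono.
pose S := [set (phi c - phi x) / (c - x) | x in [set x : R | 0 <= x < c]].
have S0 : S ((phi c - phi 0) / (c - 0)) by exists 0 => //=; rewrite lexx.
have Sub y : c < y -> ubound S ((phi y - phi c) / (y - c)).
  move=> cy _ [x /andP[x0 xc] <-].
  rewrite ler_pdivrMr ?subr_gt0// mulrAC ler_pdivlMr ?subr_gt0//.
  have := convex_chord x0 (ltW xc) (ltW cy) (lt_trans xc cy); nra.
have hS : has_sup S.
  by split; [exists ((phi c - phi 0) / (c - 0))|exists ((phi (c + 1) - phi c) / (c + 1 - c));
    apply: Sub; rewrite ltrDl].
exists (sup S).
  apply: le_trans (ub_le_sup hS.2 S0); rewrite subr0 divr_ge0 ?(ltW c0)// subr_ge0.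
  by apply: phi_mono => //; exact: ltW.
move=> y y0; case: (ltgtP y c) => [yc|cy|->]; last by [].
- have : (phi c - phi y) / (c - y) <= sup S.
    by apply: (ub_le_sup hS.2); exists y => //=; rewrite y0.
  by rewrite ler_pdivrMr ?subr_gt0//; lra.
- have : sup S <= (phi y - phi c) / (y - c).
    by apply: ge_sup; [exact: hS.1|exact: Sub].
  by rewrite ler_pdivlMr ?subr_gt0//; lra.
Qed.

Lemma measurable_phi (u : R -> R) (D : set R) : measurable (D : set (lebR R)) ->
  measurable_fun (D : set (lebR R)) u ->
  (forall x, 0 <= u x) -> measurable_fun (D : set (lebR R)) (fun x => phi (u x)).
Proof.
move=> mD mu u0; pose phi' y := phi (Num.max y 0).
have mphi' : measurable_fun [set: R] phi'.
  apply: nondecreasing_measurable => // x y xy; apply: phi_mono.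
    by rewrite le_max lexx orbT.
  by rewrite ge_max !le_max xy lexx orbT.
apply: (eq_measurable_fun (phi' \o u : lebR R -> R)); last exact: (measurableT_comp mphi' mu).
by move=> x _; rewrite /= /phi' max_l.
Qed.

Notation I01 := (`[0%R, 1%R]%classic : set (lebR R)).

Lemma integral_I01_cst (c : R) : 0 <= c -> (\int[leb R]_(x in I01) c%:E = c%:E)%E.
Proof.
move=> c0; rewrite (integral_cst (leb R) (measurable_leb_itv `[0, 1]) c%:E).
by rewrite [X in (_ * X)%E]leb_I01 mule1.
Qed.

Hypothesis phi_ge0 : forall x : R, 0 <= x -> 0 <= phi x.

(** Jensen's inequality for the probability measure with weight [a n] on the
    [n]-th copy of the unit interval. The line supporting [phi] at [c] is
    integrated in the form [phi c + m * y <= phi y + m * c], whose terms are all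
    nonnegative, and the finite number [m * c] is cancelled at the end. Since
    the slope is nonnegative it is enough that [c] be at most the mean. *)
Lemma jensen_series (a : nat -> R) (h : nat -> R -> R) (c : R) :
  (forall n, 0 <= a n) -> (\sum_(n <oo) (a n)%:E = 1)%E ->
  (forall n, measurable_fun I01 (h n)) -> (forall n x, 0 <= h n x) -> 0 <= c ->
  (c%:E <= \sum_(n <oo) (a n)%:E * \int[leb R]_(x in I01) (h n x)%:E)%E ->
  ((phi c)%:E <= \sum_(n <oo) (a n)%:E * \int[leb R]_(x in I01) (phi (h n x))%:E)%E.
Proof.
move=> a0 a1 mh h0 c0 ch; have mD : measurable I01 by exact: measurable_leb_itv.
have [m m0 line] := supporting_line c0.
have phic0 := phi_ge0 c0; have mc0 : 0 <= m * c by exact: mulr_ge0.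
have mEh n : measurable_fun I01 (fun x => (h n x)%:E).
  exact: (measurableT_comp (@EFin_measurable R setT) (mh n)).
have mEp n : measurable_fun I01 (fun x => (phi (h n x))%:E).
  exact: (measurableT_comp (@EFin_measurable R setT) (measurable_phi mD (mh n) (h0 n))).
have hE0 n x : I01 x -> (0 <= (h n x)%:E)%E by rewrite lee_fin.
have pE0 n x : I01 x -> (0 <= (phi (h n x))%:E)%E by rewrite lee_fin phi_ge0.
have H n : ((phi c)%:E + m%:E * \int[leb R]_(x in I01) (h n x)%:E <=
    \int[leb R]_(x in I01) (phi (h n x))%:E + (m * c)%:E)%E.
  rewrite -[X in (X + _)%E](integral_I01_cst phic0) -(elintegralZ mD (mEh n) (hE0 n) m0).
  rewrite -[X in (_ <= _ + X)%E](integral_I01_cst mc0).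
  have mc (b : R) : measurable_fun I01 (fun=> b%:E) by exact: measurable_cst.
  have mEmh : measurable_fun I01 (fun x => m%:E * (h n x)%:E)%E.
    exact: (emeasurable_funM (mc m) (mEh n)).
  rewrite -(elintegralD mD (mc (phi c)) mEmh); last 2 first.
  - by move=> x _; rewrite lee_fin.
  - by move=> x _; rewrite mule_ge0// lee_fin.
  rewrite -(elintegralD mD (mEp n) (mc (m * c)) (pE0 n)); last first.
    by move=> x _; rewrite lee_fin.
  apply: ge0_le_integral_nonmeas => x _.
    by rewrite adde_ge0// ?mule_ge0// lee_fin.
  by rewrite -EFinM -!EFinD lee_fin; exact: line.
have ih0 n : (0 <= \int[leb R]_(x in I01) (h n x)%:E)%E by exact: integral_ge0 (hE0 n).
have ip0 n : (0 <= \int[leb R]_(x in I01) (phi (h n x))%:E)%E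
  by exact: integral_ge0 (pE0 n).
have aE0 n : (0 <= (a n)%:E)%E by rewrite lee_fin.
have sumcst (b : R) : 0 <= b -> (\sum_(n <oo) (a n)%:E * b%:E = b%:E)%E.
  move=> b0; under eq_eseriesr do rewrite muleC.
  by rewrite nneseriesZl// a1 mule1.
have : (\sum_(n <oo) (a n)%:E * ((phi c)%:E + m%:E * \int[leb R]_(x in I01) (h n x)%:E) <=
    \sum_(n <oo) (a n)%:E * (\int[leb R]_(x in I01) (phi (h n x))%:E + (m * c)%:E))%E.
  apply: lee_nneseries => n _.
    by move=> _; apply: mule_ge0 => //; apply: adde_ge0 => //; apply: mule_ge0.
  exact: lee_wpmul2l.
under eq_eseriesr do rewrite ge0_muleDr// ?mule_ge0// muleCA.
under [X in (_ <= X)%E -> _]eq_eseriesr do rewrite ge0_muleDr//.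
rewrite !nneseriesD//; last 4 first.
- by move=> n _ _; rewrite mule_ge0.
- by move=> n _ _; rewrite mule_ge0.
- by move=> n _ _; rewrite mule_ge0.
- by move=> n _ _; rewrite !mule_ge0.
rewrite !sumcst// nneseriesZl; last by move=> n _; rewrite mule_ge0.
move=> le1; have le2 : ((phi c)%:E + (m * c)%:E <=
    \sum_(n <oo) (a n)%:E * \int[leb R]_(x in I01) (phi (h n x))%:E + (m * c)%:E)%E.
  by apply: le_trans le1; rewrite leeD2l// EFinM lee_wpmul2l.
by rewrite leeD2rE in le2.
Qed.

End Jensen.

(** * The increments of the convolution *)

(** An enumeration of the integers, which turns [\esum] over [int] into a
    series. *)
Definition int_of_nat (n : nat) : int := if odd n then Negz n./2 else Posz n./2.

Lemma int_of_nat_bij : set_bij [set: nat] [set: int] int_of_nat.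
Proof.
split=> //.
- move=> n m _ _ E; rewrite -(odd_double_half n) -(odd_double_half m); move: E.
  by rewrite /int_of_nat; case: (odd n); case: (odd m) => // -[->].
- move=> [k|k] _ /=.
    by exists k.*2 => //; rewrite /int_of_nat odd_double doubleK.
  by exists k.*2.+1 => //; rewrite /int_of_nat /= odd_double /= uphalf_double.
Qed.

Lemma esum_int {R : realType} (b : int -> \bar R) : (forall k, 0 <= b k)%E ->
  (\esum_(k in [set: int]) b k = \sum_(n <oo) b (int_of_nat n))%E.
Proof.
by move=> b0; rewrite (reindex_esum _ _ _ _ int_of_nat_bij)// nneseries_esumT.
Qed.

Section Splitting.
Context {R : realType}.
Notation I01 := (`[0%R, 1%R]%classic : set (lebR R)).

(** The closed intervals cover the line, so their indicators have a sum that is at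
    least 1 everywhere. *)
Lemma lintegral_split (g : R -> R) (l t : R) : 0 < l -> lmeas g ->
  (forall y, 0 <= g y) ->
  (\int[leb R]_y (g y)%:E <= \sum_(n <oo) \int[leb R]_(z in I01)
     (l * g (affine l (t + (int_of_nat n)%:~R * l) z))%:E)%E.
Proof.
move=> l0 mg g0; have l00 : l != 0 by rewrite gt_eqF.
pose J n : set R := affine l^-1 (- (l^-1 * (t + (int_of_nat n)%:~R * l))) @^-1` I01.
have mD : measurable I01 by exact: measurable_leb_itv.
have mJ n : measurable (J n : set (lebR R)).
  by apply: measurable_affine_preimage => //; rewrite invr_eq0.
pose u n y := g y * \1_(J n) y.
have mu n : lmeas (u n) by exact: lmeasM mg (lmeas_indic (mJ n)).
have u0 n y : (0 <= (u n y)%:E)%E by rewrite lee_fin mulr_ge0.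
apply: (@le_trans _ _ (\int[leb R]_y \sum_(n <oo) (u n y)%:E)%E).
  apply: ge0_le_integral_nonmeas => y _; first by rewrite lee_fin.
  have [n _ nE] : range int_of_nat (Num.floor ((y - t) / l)).
    by case: int_of_nat_bij => _ _; exact.
  have /andP[fy1 fy2] := floor_itv ((y - t) / l).
  have yJ : J n y.
    rewrite /J /= in_itv /= /affine nE; move: fy1 fy2.
    rewrite intrD mulr1z; set fl := (Num.floor _)%:~R => fy1 fy2.
    rewrite (_ : _ + _ = (y - t) / l - fl); last by field.
    by apply/andP; split; lra.
  rewrite (nneseriesD1 (n := n) (fun i _ => u0 i y))//.
  rewrite [X in (X + _)%E](_ : _ = (g y)%:E); last first.
    by rewrite /u indicE mem_set// mulr1.
  by rewrite leeDl//; apply: nneseries_ge0 => i _ _; exact: u0.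
rewrite (lintegral_series (fun n => lmeas_EFin (mu n)) u0).
apply: lee_nneseries => n _; first by move=> _; exact: integral_ge0.
set b := t + (int_of_nat n)%:~R * l.
have E1 : (\int[leb R]_y (u n y)%:E = \int[leb R]_(y in J n) (g y)%:E)%E.
  rewrite [RHS]integral_mkcond; apply: eq_integral => y _.
  by rewrite /u patchE indicE; case: ifP => _; rewrite ?mulr1 ?mulr0.
have mgD : measurable_fun (J n : set (lebR R)) (fun y => (g y)%:E).
  by apply: measurable_funTS; exact: lmeas_EFin.
have E2 := @ge0_integral_affine R l b (J n) (fun y => (g y)%:E) l00 (mJ n) mgD
  (fun y _ => g0 y : (0 <= (g y)%:E)%E).
have JI : affine l b @^-1` (J n) = I01.
  rewrite /J -/b -comp_preimage (_ : _ \o _ = id) ?preimage_id//.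
  by apply/funext => z /=; rewrite affineK.
rewrite JI gtr0_norm// in E2.
have mga : measurable_fun I01 (fun z => (g (affine l b z))%:E).
  by apply: measurable_funTS; apply: lmeas_EFin; exact: lmeas_affine.
under [X in (_ <= X)%E]eq_integral do rewrite EFinM.
rewrite (elintegralZ mD mga (fun z _ => g0 _ : (0 <= (g _)%:E)%E) (ltW l0)) E2 E1.
by rewrite muleA -EFinM mulfV// mul1e.
Qed.

End Splitting.

Definition kernel_sum {R : realType} (varphi : R -> R) (q : R -> \bar R)
    (F : R -> R -> R) (psi : R -> R[i]) (a : int -> R) (l t x : R) : \bar R :=
  (\esum_(k in [set: int])
    (Lp_norm q (fun z : R => varphi (l * (a k)^-1 *
       cabs (psi (x * l - (z + k%:~R) * l)))%R) / (F l (t + k%:~R * l)%R)%:E))%E.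

Section ConvolutionIncrements.
Context {R : realType} {X : completeNormedModType R[i]}.
Variables (phi varphi : R -> R).
Hypotheses (phi_ge0 : forall x : R, 0 <= x -> 0 <= phi x)
  (varphi_ge0 : forall x : R, 0 <= x -> 0 <= varphi x)
  (phi_convex : convex_function [set x : R^o | 0 <= x] phi)
  (phi_mono : forall x y : R, 0 <= x -> x <= y -> phi x <= phi y)
  (phi_varphi : forall x y : R, 0 <= x -> 0 <= y ->
     phi (x * y) <= varphi x * phi y).
Variables (p q : R -> \bar R).
Hypotheses (hp : exponent p) (hq : exponent q)
  (hpq : forall x : R, 0 <= x <= 1 -> ((p x)^-1 + (q x)^-1 = 1)%E).
Variables (F : R -> R -> R).
Hypothesis (F_gt0 : forall l t : R, 0 < l -> 0 < F l t).
Variables (psi : R -> R[i]).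
Hypothesis (hpsi : in_L1 psi).
Variables (a : int -> R).
Hypotheses (a_gt0 : forall k, 0 < a k)
  (a_sum : (\esum_(k in [set: int]) (a k)%:E = 1)%E).
Variables (f : R -> X).
Hypothesis (hf : in_Linfty f).
Notation I01 := (`[0%R, 1%R]%classic : set (lebR R)).

Notation conv := (convolution psi f).

Lemma rnorm_incr_strongly_measurable (g : R -> X) l t tau : l != 0 ->
  strongly_measurable g ->
  lmeas (fun x => rnorm (g (x * l + t + tau) - g (t + x * l))).
Proof.
move=> l0 mg.
have -> : (fun x => rnorm (g (x * l + t + tau) - g (t + x * l))) =
    (fun x => rnorm ((g \o affine l (t + tau)) x - (g \o affine l t) x)).
  by apply/funext => x; rewrite /affine /=; congr (rnorm (g _ - g _)); ring.
by apply: measurable_rnorm; apply: strongly_measurableB; exact: strongly_measurable_affine.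
Qed.

Lemma increments_convolution_in_Lp p1 : exponent p1 ->
  increments_in_Lp p1 phi conv.
Proof.
move=> hp1 tau t l l0; have [K K0 cK] := convolution_bounded hpsi hf.
have mD : measurable I01 by exact: measurable_leb_itv.
have l00 : l != 0 by rewrite gt_eqF.
apply: (in_Lp_bounded (K := phi (K + K)) hp1).
  apply: (measurable_phi phi_mono mD); last by move=> x; exact: rnorm_ge0.
  apply: measurable_funTS; apply: rnorm_incr_strongly_measurable => //.
  exact: strongly_measurable_convolution.
move=> x; rewrite /increment ger0_norm ?phi_ge0 ?rnorm_ge0//.
apply: phi_mono; first exact: rnorm_ge0.
by apply: le_trans (ler_rnormB _ _) _; exact: lerD.
Qed.

(** The pointwise estimate. The increment of [conv] is at most the integral of
    [g y = |psi (x * l + t - y)| * |f (y + tau) - f y|]; cut into intervals of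
    length [l] it becomes the mean of the functions [h n] with weights
    [a (k n)], and Jensen's inequality moves [phi] inside. On each interval
    [phi_varphi] separates [psi] from [f] and the Hoelder inequality applies. *)
Lemma phi_increment_le (l t tau x e : R) : 0 < l -> 0 < e ->
  (forall s, (F l s)%:E * Lp_norm p (increment phi f l s tau) <= e%:E)%E ->
  ((increment phi conv l t tau x)%:E <= (2 * e)%:E * kernel_sum varphi q F psi a l t x)%E.
Proof.
move=> l0 e0 Fe; have l00 : l != 0 by rewrite gt_eqF.
have mD : measurable I01 by exact: measurable_leb_itv.
have [mRe mIm _] := hpsi.
have mpsi : lmeas (fun y => cabs (psi (x * l + t - y))).
  rewrite (sub_affine (fun z => cabs (psi z))); apply: lmeas_affine.
    by rewrite oppr_eq0 oner_neq0.
  exact: lmeas_cabs.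
have mdf : lmeas (fun y => rnorm (f (y + tau) - f y)).
  have := rnorm_incr_strongly_measurable 0 tau (oner_neq0 R) hf.1.
  by under eq_fun do rewrite mulr1 addr0 add0r.
pose g y := cabs (psi (x * l + t - y)) * rnorm (f (y + tau) - f y).
have mg : lmeas g by exact: lmeasM.
have g0 y : 0 <= g y by rewrite mulr_ge0 ?cabs_ge0 ?rnorm_ge0.
pose k n := int_of_nat n.
pose h n z := (a (k n))^-1 * (l * g (affine l (t + (k n)%:~R * l) z)).
have a0 n : 0 <= a n by exact: ltW.
have aN0 n : a n != 0 by rewrite gt_eqF.
have h0 n z : 0 <= h n z by rewrite /h mulr_ge0 ?invr_ge0// mulr_ge0// ltW.
have mh n : lmeas (h n).
  exact: (lmeasM (lmeas_cst _) (lmeasM (lmeas_cst _) (lmeas_affine _ l00 mg))).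
have mhD n : measurable_fun I01 (h n) by exact: measurable_funTS.
have aoo : (\sum_(n <oo) (a (k n))%:E = 1)%E.
  by rewrite -a_sum esum_int// => i; rewrite lee_fin.
set N := rnorm (conv (x * l + t + tau) - conv (t + x * l)).
have N0 : 0 <= N by exact: rnorm_ge0.
have NG : (N%:E <= \sum_(n <oo) (a (k n))%:E *
    \int[leb R]_(z in I01) (h n z)%:E)%E.
  apply: (@le_trans _ _ (\int[leb R]_y (g y)%:E)%E).
    rewrite /N (addrC t); exact: convolution_increment_le.
  apply: le_trans (lintegral_split t l0 mg g0) _.
  rewrite le_eqVlt; apply/orP; left; apply/eqP; apply: eq_eseriesr => n _.
  have mEh := measurableT_comp (@EFin_measurable R setT) (mhD n).
  rewrite -(elintegralZ mD mEh (fun z _ => h0 n z : (0 <= (h n z)%:E)%E) (a0 (k n))).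
  by apply: eq_integral => z _; rewrite -EFinM /h mulVKf.
have := jensen_series phi_convex phi_mono phi_ge0 (fun n => a0 (k n)) aoo mhD h0 N0 NG.
rewrite -[phi N]/(increment phi conv l t tau x) => /le_trans; apply.
have Fk0 n : 0 < F l (t + (k n)%:~R * l) by exact: F_gt0.
rewrite /kernel_sum esum_int; last first.
  by move=> i; rewrite mule_ge0 ?Lp_norm_ge0// inve_ge0 lee_fin ltW// F_gt0.
rewrite -nneseriesZl; last first.
  by move=> n _; rewrite mule_ge0 ?Lp_norm_ge0// inve_ge0 lee_fin ltW.
have ip0 n : (0 <= \int[leb R]_(z in I01) (phi (h n z))%:E)%E.
  by apply: integral_ge0 => z _; rewrite lee_fin phi_ge0.
apply: lee_nneseries => n _; first by move=> _; rewrite mule_ge0// lee_fin.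
set s := t + (k n)%:~R * l.
set v := (fun z : R => varphi _).
have Fs0 : 0 < F l s by exact: F_gt0.
apply: (@le_trans _ _ (\int[leb R]_(z in I01) (phi (h n z))%:E)%E).
  (* [a (k n) <= 1], being a term of a series of sum 1. *)
  rewrite -[leRHS]mul1e; apply: lee_wpmul2r => //.
  rewrite -aoo (nneseriesD1 (n := n))//; last by move=> i _; rewrite lee_fin.
  by rewrite leeDl//; apply: nneseries_ge0 => i _ _; rewrite lee_fin.
apply: (@le_trans _ _ (\int[leb R]_(z in I01)
    (`|increment phi f l s tau z| * `|v z|)%:E)%E).
  apply: ge0_le_integral_nonmeas => z _; first by rewrite lee_fin phi_ge0.
  have w0 : 0 <= l * (a (k n))^-1 * cabs (psi (x * l - (z + (k n)%:~R) * l)).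
    by rewrite mulr_ge0 ?cabs_ge0// mulr_ge0 ?invr_ge0// ltW.
  rewrite lee_fin [leRHS]mulrC /v /increment !ger0_norm ?phi_ge0 ?varphi_ge0 ?rnorm_ge0//.
  apply: le_trans (phi_varphi w0 (rnorm_ge0 _)).
  rewrite le_eqVlt; apply/orP; left; apply/eqP; congr phi.
  rewrite /h /g /affine /s !mulrA (mulrC l); congr (_ * cabs (psi _) * rnorm (f _ - f _));
    ring.
have es : (Lp_norm p (increment phi f l s tau) <= (e / F l s)%:E)%E.
  by have := Fe s; rewrite -lee_pdivlMl// -EFinM mulrC.
have es0 : 0 < e / F l s by rewrite divr_gt0.
apply: le_trans (Lp_norm_hoelder v hp hq hpq es0 es) _.
rewrite inver gt_eqF// muleCA -EFinM.
by rewrite muleC (_ : 2 * (e / F l s) = 2 * e / F l s)//; ring.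
Qed.

(** The same [l] and [tau] serve for [f] and for its convolution. It is compared
    with every real [e > 0] above the right-hand side, since that side may
    vanish while [phi_increment_le] needs [e > 0]. *)
Lemma sup_increment_convolution_le p1 F1 (l tau : R) : exponent p1 ->
  (forall l t : R, 0 < l -> 0 < F1 l t) -> 0 < l ->
  (forall t : R, modular p1 (fun x : R => (2 * F1 l t)%R%:E * kernel_sum varphi q F psi a l t x) <= 1)%E ->
  (sup_increment p1 phi F1 conv tau l <= sup_increment p phi F f tau l)%E.
Proof.
move=> hp1 F10 l0 hmod; set S := (X in (_ <= X)%E).
have S0 : (0 <= S)%E.
  apply: ereal_sup_ge; exists ((F l 0)%:E * Lp_norm p (increment phi f l 0 tau))%E.
    by exists 0.
  by rewrite mule_ge0 ?Lp_norm_ge0// lee_fin ltW// F_gt0.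
suff H e : 0 < e -> (S <= e%:E)%E -> (sup_increment p1 phi F1 conv tau l <= e%:E)%E.
  case: S S0 H => [r| |] //; last by move=> _ _; rewrite leey.
  rewrite lee_fin => r0 H; apply/lee_addgt0Pr => e e0; rewrite -EFinD; apply: H.
    by rewrite ltr_wpDl.
  by rewrite lee_fin lerDl ltW.
move=> e0 Se; apply: ge_ereal_sup => _ [t _ <-].
have F1t := F10 l t l0.
have Fe s : ((F l s)%:E * Lp_norm p (increment phi f l s tau) <= e%:E)%E.
  by apply: le_trans Se; apply: ereal_sup_ubound; exists s.
rewrite -lee_pdivlMl//; apply: ereal_inf_lbound; exists ((F1 l t)^-1 * e) => //.
have eF0 : 0 < (F1 l t)^-1 * e by rewrite mulr_gt0// invr_gt0.
split=> //; first exact: (increments_convolution_in_Lp hp1 tau t l0).1.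
apply: le_trans (hmod t); apply: (le_modular hp1) => x x01.
  by rewrite lee_fin divr_ge0// ltW.
have i0 : 0 <= increment phi conv l t tau x by rewrite phi_ge0// rnorm_ge0.
rewrite ger0_norm// (_ : _ / _ = (F1 l t / e) * increment phi conv l t tau x); last first.
  by field; rewrite !gt_eqF.
rewrite EFinM; apply: (@le_trans _ _ ((F1 l t / e)%:E * ((2 * e)%:E * kernel_sum varphi q F psi a l t x))%E).
  apply: lee_wpmul2l; first by rewrite lee_fin divr_ge0// ltW.
  exact: phi_increment_le.
rewrite muleA -EFinM (_ : F1 l t / e * (2 * e) = 2 * F1 l t)//.
by field; rewrite gt_eqF.
Qed.

End ConvolutionIncrements.

(** * Upper limits at infinity and the conclusion *)

Lemma le_limf_esup_pinfty {R : realType} (u v : R -> \bar R) :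
  (forall l, 0 < l -> (u l <= v l)%E) ->
  (limf_esup u (pinfty_nbhs R) <= limf_esup v (pinfty_nbhs R))%E.
Proof.
move=> uv; apply: le_ereal_inf_tmp => _ [V FV <-].
apply: (@le_trans _ _ (ereal_sup (u @` (V `&` [set l | 0 < l])))).
  apply: ereal_inf_lbound; exists (V `&` [set l | 0 < l]) => //.
  by apply: filterI => //; exact: nbhs_pinfty_gt.
apply: ge_ereal_sup => _ [l [Vl l0] <-]; apply: le_trans (uv _ l0) _.
by apply: ereal_sup_ubound; exists l.
Qed.

Theorem proposition4p13 (R : realType) (X : completeNormedModType R[i])
  (phi varphi : R -> R)
  (phi_ge0 : forall x : R, 0 <= x -> 0 <= phi x)
  (varphi_ge0 : forall x : R, 0 <= x -> 0 <= varphi x)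
  (phi_convex : convex_function [set x : R^o | 0 <= x] phi)
  (phi_mono : forall x y : R, 0 <= x -> x <= y -> phi x <= phi y)
  (phi_varphi : forall x y : R, 0 <= x -> 0 <= y ->
     phi (x * y) <= varphi x * phi y)
  (p q : R -> \bar R) (hp : exponent p) (hq : exponent q)
  (hpq : forall x : R, 0 <= x <= 1 -> ((p x)^-1 + (q x)^-1 = 1)%E)
  (F : R -> R -> R) (F_gt0 : forall l t : R, 0 < l -> 0 < F l t)
  (psi : R -> R[i]) (hpsi : in_L1 psi)
  (a : int -> R) (a_gt0 : forall k, 0 < a k)
  (a_sum : (\esum_(k in [set: int]) (a k)%:E = 1)%E)
  (f : R -> X) (hf : in_Linfty f) :
  let conclusion
    (ap : (R -> \bar R) -> (R -> R) -> (R -> R -> R) -> (R -> X) -> Prop) :=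
    ap p phi F f ->
    [/\ forall x : R, bochner_integrable (fun y => psi (x - y) *: f y),
        in_Linfty (convolution psi f) &
        forall (p1 : R -> \bar R) (F1 : R -> R -> R),
          exponent p1 ->
          (forall l t : R, 0 < l -> 0 < F1 l t) ->
          (forall t l : R, 0 < l ->
             (modular p1 (fun x : R =>
                (2 * F1 l t)%R%:E *
                \esum_(k in [set: int])
                  (Lp_norm q (fun z : R =>
                     varphi (l * (a k)^-1 *
                             cabs (psi (x * l - (z + k%:~R) * l)))%R)
                   / (F l (t + k%:~R * l)%R)%:E)) <= 1)%E) ->
          ap p1 phi F1 (convolution psi f)] in
  conclusion (@equi_weyl_ap R X) /\ conclusion (@weyl_ap R X).
Proof.
have key p1 F1 l tau : exponent p1 -> (forall l t : R, 0 < l -> 0 < F1 l t) ->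
    (forall t l : R, 0 < l ->
       (modular p1 (fun x : R => (2 * F1 l t)%R%:E *
          kernel_sum varphi q F psi a l t x) <= 1)%E) ->
    0 < l -> (sup_increment p1 phi F1 (convolution psi f) tau l <=
      sup_increment p phi F f tau l)%E.
  move=> hp1 F10 hmod l0.
  exact: (sup_increment_convolution_le phi_ge0 varphi_ge0 phi_convex phi_mono
    phi_varphi hp hq hpq F_gt0 hpsi a_gt0 a_sum hf tau hp1 F10 l0
    (fun t => hmod t l l0)).
have incr p1 : exponent p1 -> increments_in_Lp p1 phi (convolution psi f).
  exact: increments_convolution_in_Lp.
split=> -[_ ap]; split.
- exact: bochner_integrable_convolutant.
- exact: in_Linfty_convolution.
- move=> p1 F1 hp1 F10 hmod; split; first exact: incr.
  move=> eps /ap[l [L [l0 L0 HI]]]; exists l, L.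
  split; [exact: l0|exact: L0|move=> I itI lI].
  have [tau Itau taule] := HI I itI lI; exists tau; first exact: Itau.
  exact: le_trans (key p1 F1 l tau hp1 F10 hmod l0) taule.
- exact: bochner_integrable_convolutant.
- exact: in_Linfty_convolution.
- move=> p1 F1 hp1 F10 hmod; split; first exact: incr.
  move=> eps /ap[L [L0 HI]]; exists L.
  split; [exact: L0|move=> I itI lI].
  have [tau Itau taule] := HI I itI lI; exists tau; first exact: Itau.
  apply: le_trans taule; apply: le_limf_esup_pinfty => l l0.
  exact: (key p1 F1 l tau hp1 F10 hmod l0).
Qed.
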